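(* Let $\mathscr H$ be a complex Hilbert space, let $\sigma_f$ be an operator mean with representing function $f$, let $m,M$ be positive real numbers with $m<1<M$, and put $$\mu_f=\frac{f(M)-f(m)}{M-m},\qquad \nu_f=\frac{Mf(m)-mf(M)}{M-m},\qquad \gamma_f=\max_{m\le t\le M}\frac{f(t)}{\mu_f t+\nu_f}.$$ Let $A_j,B_j\in\mathbb B(\mathscr H)$ $(1\le j\le n)$ satisfy $0<mA_j\le B_j\le MA_j$ for $1\le j\le n$ and $$0<m\Big(I_{\mathscr H}-\gamma_f\sum_{j=1}^nA_j\Big)\le I_{\mathscr H}-\gamma_f\sum_{j=1}^nB_j\le M\Big(I_{\mathscr H}-\gamma_f\sum_{j=1}^nA_j\Big),$$ and let $p\in[0,1]$. Then $$\gamma_f^p\left(\Big(I_{\mathscr H}-\sum_{j=1}^nA_j\Big)\sigma_f\Big(I_{\mathscr H}-\sum_{j=1}^nB_j\Big)\right)^p\ge\left(I_{\mathscr H}-\gamma_f\sum_{j=1}^n(A_j\sigma_fB_j)\right)^p.$$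
   Context: $\mathbb B(\mathscr H)$ is the algebra of bounded linear operators on $\mathscr H$, with identity $I_{\mathscr H}$. $A\ge0$ means $\langle Ax,x\rangle\ge0$ for all $x$; $A>0$ means $A\ge 0$ and $A$ is invertible; $A\le B$ means $B-A\ge0$ (for self-adjoint $A,B$). An operator mean (in the sense of Kubo and Ando) with representing function $f$ is the operation $A\sigma_fB=A^{1/2}f(A^{-1/2}BA^{-1/2})A^{1/2}$ on positive invertible operators, where $f:(0,\infty)\to(0,\infty)$ is operator monotone ($A\le B$ implies $f(A)\le f(B)$) and $f(1)=1$. Powers of positive operators are defined by functional calculus, with $X^0=I_{\mathscr H}$. *)

(* Defs.v *)
From HB Require Import structures.
From mathcomp Require Import all_boot all_order all_algebra.
From mathcomp Require Import complex ring.
From mathcomp Require Import all_classical all_reals all_analysis.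

Set Implicit Arguments.
Unset Strict Implicit.
Unset Printing Implicit Defensive.

Import Order.TTheory GRing.Theory Num.Theory.
Import numFieldNormedType.Exports.

Local Open Scope classical_set_scope.
Local Open Scope ring_scope.
Local Open Scope complex_scope.

(* Complex Hilbert spaces. The inner product is linear in its first argument
   and conjugate-linear in the second. *)
HB.mixin Record CompleteNormedModule_isHilbert (R : realType) H
    & CompleteNormedModule R[i] H := {
  inner : {dot H for (@Num.conj R[i])} ;
  inner_normE : forall x : H, inner x x = `|x| ^+ 2
}.

#[short(type="hilbertType")]
HB.structure Definition Hilbert (R : realType) :=
  {H of CompleteNormedModule R[i] H & CompleteNormedModule_isHilbert R H}.

Section BoundedOperators.
Context (R : realType) (H : hilbertType R).

Definition bounded_linear (T : H -> H) : Prop :=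
  linear T /\ exists M : R, forall x, `|T x| <= M%:C * `|x|.

Record bop : Type := Bop {
  bop_fun :> H -> H ;
  bop_funP : bop_fun \in [pred T | `[< bounded_linear T >]] }.

HB.instance Definition _ := [isSub for bop_fun].
HB.instance Definition _ := [Choice of bop by <:].

Implicit Types (A B C : bop) (x y : H).

Lemma bop_bounded_linear A : bounded_linear A.
Proof. by apply/asboolP; have := bop_funP A; rewrite inE. Qed.

Lemma bop_linear A : linear A.
Proof. by have [] := bop_bounded_linear A. Qed.

Lemma bop_bound A : exists2 M : R, 0 <= M & forall x, `|A x| <= M%:C * `|x|.
Proof.
have [_ [M AM]] := bop_bounded_linear A.
exists `|M| => // x; apply: (le_trans (AM x)).
by rewrite ler_wpM2r// lecR ler_norm.
Qed.

Definition mk_bop (T : H -> H) (hT : bounded_linear T) : bop :=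
  @Bop T (introT (asboolP _) hT).

Lemma bopP A B : A = B <-> forall x, A x = B x.
Proof. by split=> [->//|AB]; apply/val_inj/funext. Qed.

Lemma bounded_linear0 : bounded_linear (fun=> 0).
Proof.
split=> [a x y|]; first by rewrite scaler0 addr0.
by exists 0 => x; rewrite normr0 mul0r.
Qed.

Lemma bounded_linear1 : bounded_linear idfun.
Proof. by split=> //; exists 1 => x; rewrite mul1r. Qed.

Lemma bounded_linearD A B : bounded_linear (fun x => A x + B x).
Proof.
split=> [a x y|]; first by rewrite !bop_linear scalerDr addrACA.
have [M _ AM] := bop_bound A; have [N _ BN] := bop_bound B.
exists (M + N) => x; rewrite rmorphD/= mulrDl.
by rewrite (le_trans (ler_normD _ _))// lerD.
Qed.

Lemma bounded_linearZ (a : R[i]) A : bounded_linear (fun x => a *: A x).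
Proof.
split=> [b x y|].
  by rewrite bop_linear scalerDr !scalerA mulrC.
have [M _ AM] := bop_bound A.
exists (complex.Re `|a| * M) => x; rewrite normrZ rmorphM/=.
have -> : (complex.Re `|a|)%:C = `|a| by rewrite RRe_real ?normr_real.
by rewrite -mulrA ler_wpM2l.
Qed.

Lemma bounded_linearN A : bounded_linear (fun x => - A x).
Proof.
have := bounded_linearZ (-1) A.
by under eq_fun do rewrite scaleN1r.
Qed.

Lemma bounded_linearM A B : bounded_linear (A \o B).
Proof.
split=> [a x y|]; first by rewrite /= !bop_linear.
have [M M0 AM] := bop_bound A; have [N _ BN] := bop_bound B.
exists (M * N) => x /=; rewrite (le_trans (AM _))// rmorphM/= -mulrA.
by rewrite ler_wpM2l// lecR.
Qed.

Definition bop_zero := mk_bop bounded_linear0.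
Definition bop_one := mk_bop bounded_linear1.
Definition bop_add A B := mk_bop (bounded_linearD A B).
Definition bop_opp A := mk_bop (bounded_linearN A).
Definition bop_scale (a : R[i]) A := mk_bop (bounded_linearZ a A).
Definition bop_mul A B := mk_bop (bounded_linearM A B).

Lemma bop_addA : associative bop_add.
Proof. by move=> A B C; apply/bopP => x /=; rewrite addrA. Qed.
Lemma bop_addC : commutative bop_add.
Proof. by move=> A B; apply/bopP => x /=; rewrite addrC. Qed.
Lemma bop_add0 : left_id bop_zero bop_add.
Proof. by move=> A; apply/bopP => x /=; rewrite add0r. Qed.
Lemma bop_addN : left_inverse bop_zero bop_opp bop_add.
Proof. by move=> A; apply/bopP => x /=; rewrite addNr. Qed.

HB.instance Definition _ :=
  GRing.isZmodule.Build bop bop_addA bop_addC bop_add0 bop_addN.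

Lemma bop_mulA : associative bop_mul.
Proof. by move=> A B C; apply/bopP. Qed.
Lemma bop_mul1l : left_id bop_one bop_mul.
Proof. by move=> A; apply/bopP. Qed.
Lemma bop_mul1r : right_id bop_one bop_mul.
Proof. by move=> A; apply/bopP. Qed.
Lemma bop_mulDl : left_distributive bop_mul +%R.
Proof. by move=> A B C; apply/bopP. Qed.
Lemma bop_mulDr : right_distributive bop_mul +%R.
Proof.
move=> A B C; apply/bopP => x /=.
by have := bop_linear A 1 (B x) (C x); rewrite !scale1r.
Qed.

(* The zero Hilbert space is allowed, and there 1 = 0 in B(H). *)
HB.instance Definition _ := GRing.Zmodule_isPzRing.Build bop
  bop_mulA bop_mul1l bop_mul1r bop_mulDl bop_mulDr.

Lemma bop_scaleA (a b : R[i]) A :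
  bop_scale a (bop_scale b A) = bop_scale (a * b) A.
Proof. by apply/bopP => x /=; rewrite scalerA. Qed.
Lemma bop_scale1 : left_id 1 bop_scale.
Proof. by move=> A; apply/bopP => x /=; rewrite scale1r. Qed.
Lemma bop_scaleDr : right_distributive bop_scale +%R.
Proof. by move=> a A B; apply/bopP => x /=; rewrite scalerDr. Qed.
Lemma bop_scaleDl A : {morph bop_scale^~ A : a b / a + b}.
Proof. by move=> a b; apply/bopP => x /=; rewrite scalerDl. Qed.

HB.instance Definition _ := GRing.Zmodule_isLmodule.Build R[i] bop
  bop_scaleA bop_scale1 bop_scaleDr bop_scaleDl.

Definition op_invertible A : Prop := exists B : bop, A * B = 1 /\ B * A = 1.

(* The order of R[i] makes [0 <= z] entail that z is real. *)
Definition op_ge0 A : Prop := forall x, 0 <= inner (A x) x.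
Definition op_gt0 A : Prop := op_ge0 A /\ op_invertible A.
Definition op_le A B : Prop := op_ge0 (B - A).

Definition spectrum A : set R[i] := [set l | ~ op_invertible (A - l *: (1 : bop))].

Definition op_poly (p : {poly R}) A : bop :=
  \sum_(i < size p) (p`_i)%:C *: A ^+ i.

(* Continuous functional calculus of a self-adjoint A (whose spectrum is real):
   f(A) is the operator-norm limit of p_k(A) for real polynomials p_k that
   converge to f uniformly on the spectrum of A. *)
Definition is_fun_calc (f : R -> R) A (T : bop) : Prop :=
  forall e : R, 0 < e -> exists p : {poly R},
    (forall t : R, spectrum A t%:C -> `|p.[t] - f t| <= e) /\
    (forall x, `|(op_poly p A - T) x| <= e%:C * `|x|).

Definition fun_calc (f : R -> R) A : bop := xget 0 [set T | is_fun_calc f A T].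

(* [powR 0 0 = 1], so that [op_pow A 0] is the identity. *)
Definition op_pow A (p : R) : bop := fun_calc (fun t => t `^ p) A.

Definition op_mean (f : R -> R) A B : bop :=
  op_pow A 2^-1 *
  fun_calc f (op_pow A (- 2^-1) * B * op_pow A (- 2^-1)) *
  op_pow A 2^-1.

End BoundedOperators.

Section RepresentingFunctions.
Context (R : realType).
Implicit Types (f : R -> R) (m M : R).

(* Only the values of f on ]0, +oo[ matter. As usual for the functional
   calculus, f is continuous there; operator monotonicity is required on every
   Hilbert space (on a fixed one of finite dimension it is a weaker notion). *)
Definition operator_monotone f : Prop :=
  (forall t, 0 < t -> {for t, continuous f}) /\
  forall (K : hilbertType R) (A B : bop K), op_gt0 A -> op_gt0 B ->
    op_le A B -> op_le (fun_calc f A) (fun_calc f B).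

Definition representing_function f : Prop :=
  [/\ forall t, 0 < t -> 0 < f t, operator_monotone f & f 1 = 1].

Definition chord_slope f m M : R := (f M - f m) / (M - m).
Definition chord_icpt f m M : R := (M * f m - m * f M) / (M - m).

Definition chord_ratio f m M (t : R) : R :=
  f t / (chord_slope f m M * t + chord_icpt f m M).

(* A maximum for every continuous positive f, see [chord_gamma_max]. *)
Definition chord_gamma f m M : R := sup (chord_ratio f m M @` `[m, M]).

Lemma chord_gamma_max f m M : representing_function f -> 0 < m -> m < M ->
  (exists2 t, m <= t <= M & chord_gamma f m M = chord_ratio f m M t) /\
  (forall t, m <= t <= M -> chord_ratio f m M t <= chord_gamma f m M).
Proof.
move=> [f0 [fc _] _] m0 mM; have M0 : 0 < M by exact: lt_trans mM.
have Mm : 0 < M - m by rewrite subr_gt0.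
have chord_gt0 t : m <= t <= M ->
    0 < chord_slope f m M * t + chord_icpt f m M.
  move=> /andP[mt tM].
  have -> : chord_slope f m M * t + chord_icpt f m M =
      (f M * (t - m) + f m * (M - t)) / (M - m).
    by rewrite /chord_slope /chord_icpt mulrAC -mulrDl; congr (_ / _); ring.
  rewrite divr_gt0//; have [->|tm] := eqVneq t m.
    by rewrite subrr mulr0 add0r mulr_gt0 ?f0.
  rewrite ltr_pwDl//; last by rewrite mulr_ge0 ?subr_ge0// ltW ?f0.
  by rewrite mulr_gt0 ?f0// subr_gt0 lt_neqAle eq_sym tm.
have cr : {within `[m, M], continuous (chord_ratio f m M)}.
  apply: continuous_in_subspaceT => s; rewrite inE/= in_itv/= => smM.
  have s0 : 0 < s by case/andP: smM => ms _; exact: lt_le_trans ms.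
  apply: cvgM; first exact: fc.
  apply: cvgV; first by rewrite gt_eqF// chord_gt0.
  by apply: cvgD; [apply: cvgM; [exact: cvg_cst|exact: cvg_id]|exact: cvg_cst].
have [c cmM cmax] := EVT_max (ltW mM) cr.
have {}cmM : m <= c <= M by move: cmM; rewrite in_itv.
have gE : chord_gamma f m M = chord_ratio f m M c.
  apply/eqP; rewrite eq_le; apply/andP; split.
    apply: ge_sup; first by exists (chord_ratio f m M c), c => //=; rewrite in_itv.
    by move=> _ [t tmM <-]; exact: cmax.
  apply: ub_le_sup; last by exists c => //=; rewrite in_itv.
  by exists (chord_ratio f m M c) => _ [t tmM <-]; exact: cmax.
split; first by exists c.
by move=> t tmM; rewrite gE cmax// in_itv.
Qed.

End RepresentingFunctions.

(* Main.v *)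
(** Since [f] is operator monotone it is concave on (0, +oo): compressing a
    diagonal operator to a unit vector can be compared, up to an arbitrarily
    small error, with an operator having that vector as an eigenvector, and a
    two-dimensional space suffices (here inside the Hilbert sum of [H] with
    itself). Hence on [m, M] the function [f] lies above its chord
    [mu t + nu] and below a line [k t + (1 - k)] that is positive on [m, M].

    With [C = 1 - sum A_j] and [D = 1 - sum B_j] one still has
    [m C <= D <= M C], so the chord bound for [C sigma D] and for every
    [A_j sigma B_j], together with [gamma (mu + nu) >= f 1 = 1], gives
    [1 - gamma sum (A_j sigma B_j) <= gamma (C sigma D)]. The line above [f]
    shows that the left-hand side is strictly positive, and the power [p] is
    then taken by the Loewner-Heinz inequality, which is proved by Pedersen's
    spectral argument at dyadic exponents. *)

From HB Require Import structures.
Require Import Defs.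
From mathcomp Require Import all_boot all_order all_algebra.
From mathcomp Require Import complex ring lra.
From mathcomp Require Import all_classical all_reals all_analysis.

Set Implicit Arguments.
Unset Strict Implicit.
Unset Printing Implicit Defensive.

Import Order.TTheory GRing.Theory Num.Theory.
Import numFieldNormedType.Exports.

Local Open Scope classical_set_scope.
Local Open Scope ring_scope.
Local Open Scope complex_scope.

(** * Hilbert spaces through their real inner product *)

(** [fun_calc] and [op_pow] are choices made by [xget], so nothing can be said about them before the
    calculus is known to exist and to be unique; both rest on bounding a real polynomial of a
    self-adjoint operator by its values on the spectrum. That bound and Pedersen's argument share
    one source, [spectrum_lb]: if T - l is invertible for every real l < c, then T >= c. It is
    derived from the Neumann series and Cauchy-Schwarz alone, since square roots of operators are
    themselves values of the calculus and cannot be used to build it.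

    A function [f] is only known to be continuous on ]0, +oo[, so each operator fed to the calculus
    must first be bounded below by a positive constant; this is why strict positivity is proved so
    often.

    In the last argument only affine bounds of [f] are usable: conjugated by A^(1/2) they become
    linear in the pair (A, B), so they add up over j and everything reduces to scalar inequalities
    between quadratic forms at one vector. *)

Section RealInner.
Context (R : realType) (H : hilbertType R).
Implicit Types (A B T : bop H) (x y z : H) (a b c : R).

Definition ip x y : R := complex.Re (inner x y).
Definition nm x : R := complex.Re `|x|.

Lemma nmE x : (nm x)%:C = `|x|.
Proof. by rewrite /nm RRe_real ?normr_real. Qed.

Lemma nm_ge0 x : 0 <= nm x.
Proof. by rewrite -ler0c nmE. Qed.

Lemma le_nm x y c : (nm x <= c * nm y) = (`|x| <= c%:C * `|y|).
Proof. by rewrite -!nmE -rmorphM /= lecR. Qed.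

Lemma nm_sqr x : nm x ^+ 2 = ip x x.
Proof. by rewrite /ip inner_normE -nmE -rmorphXn. Qed.

Lemma nmD x y : nm (x + y) <= nm x + nm y.
Proof. by rewrite -lecR rmorphD /= !nmE ler_normD. Qed.

Lemma nmN x : nm (- x) = nm x.
Proof. by rewrite /nm normrN. Qed.

Lemma nmB x y : nm (x - y) <= nm x + nm y.
Proof. by rewrite -(nmN y) nmD. Qed.

Lemma nm0 : nm 0 = 0.
Proof. by rewrite /nm normr0. Qed.

Lemma nm_eq0 x : nm x = 0 -> x = 0.
Proof. by move=> x0; apply/normr0_eq0; rewrite -nmE x0. Qed.

Lemma nmZ a x : nm (a%:C *: x) = `|a| * nm x.
Proof. by apply: complexI; rewrite nmE normrZ rmorphM /= nmE normc_def /= expr0n addr0 sqrtr_sqr. Qed.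

Lemma innerC x y : inner x y = (inner y x)^*.
Proof. by rewrite [LHS]hermC /= expr0 mul1r. Qed.

Lemma ipC x y : ip x y = ip y x.
Proof. by rewrite /ip innerC; case: (inner y x). Qed.

Lemma ReD (u v : R[i]) : complex.Re (u + v) = complex.Re u + complex.Re v.
Proof. by case: u v => [? ?] [? ?]. Qed.

Lemma ipDl x y z : ip (x + y) z = ip x z + ip y z.
Proof. by rewrite /ip linearDl /= ReD. Qed.

Lemma ipDr x y z : ip x (y + z) = ip x y + ip x z.
Proof. by rewrite !(ipC x) ipDl. Qed.

Lemma ipZl a x y : ip (a%:C *: x) y = a * ip x y.
Proof. by rewrite /ip linearZl_LR /=; case: (inner x y) => u v /=; rewrite mul0r subr0. Qed.

Lemma ipZr a x y : ip x (a%:C *: y) = a * ip x y.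
Proof. by rewrite !(ipC x) ipZl. Qed.

Lemma ipNl x y : ip (- x) y = - ip x y.
Proof. by have := ipZl (-1) x y; rewrite rmorphN1 scaleN1r mulN1r. Qed.

Lemma ipNr x y : ip x (- y) = - ip x y.
Proof. by rewrite !(ipC x) ipNl. Qed.

Lemma ip0l y : ip 0 y = 0.
Proof. by have := ipDl 0 0 y; rewrite addr0; lra. Qed.

Lemma ip0r y : ip y 0 = 0.
Proof. by rewrite ipC ip0l. Qed.

Definition ipE := (ipDl, ipDr, ipNl, ipNr, ipZl, ipZr, ip0l, ip0r).

Lemma ip_ge0 x : 0 <= ip x x.
Proof. by rewrite -nm_sqr sqr_ge0. Qed.

Lemma Im_inner x y : complex.Im (inner x y) = ip x ('i *: y).
Proof.
rewrite /ip linearZr_LR /=; case: (inner x y) => u v /=.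
by rewrite mul0r; lra.
Qed.

Lemma bopD A x y : A (x + y) = A x + A y.
Proof. by have := bop_linear A 1 x y; rewrite !scale1r. Qed.

Lemma bop0 A : A 0 = 0.
Proof. by have := bopD A 0 0; rewrite addr0 => /(congr1 (+%R (- A 0))); rewrite addNr addKr. Qed.

Lemma bopZ A (k : R[i]) x : A (k *: x) = k *: A x.
Proof. by have := bop_linear A k x 0; rewrite !addr0 bop0 addr0. Qed.

Lemma bopN A x : A (- x) = - A x.
Proof. by rewrite -scaleN1r bopZ scaleN1r. Qed.

Lemma bop_bound_nm A : exists2 M : R, 0 < M & forall x, nm (A x) <= M * nm x.
Proof.
have [M M0 hM] := bop_bound A; exists (M + 1); first by lra.
move=> x; have := hM x; rewrite -le_nm => /le_trans; apply.
by rewrite ler_wpM2r ?nm_ge0 //; lra.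
Qed.

(** Real parts suffice: putting ['i *: y] for [y] recovers the imaginary parts, so this is
    self-adjointness over the complex numbers. *)
Definition sa A := forall x y, ip (A x) y = ip x (A y).

(* A nonnegative operator has real quadratic form, so polarization over the
   complex numbers makes it self-adjoint. *)
Lemma op_ge0P A : op_ge0 A <-> sa A /\ forall x, 0 <= ip (A x) x.
Proof.
split=> [A0|[Asa A0] x]; last first.
  rewrite lecE /= (A0 x) andbT Im_inner.
  have := Asa x ('i *: x).
  rewrite bopZ -!Im_inner innerC => E; apply/eqP; move: E.
  by case: (inner x (A x)) => u v /=; lra.
split=> [x y|x]; last by have := A0 x; rewrite lecE => /andP[].
have Re0 z : complex.Im (inner (A z) z) = 0.
  by have := A0 z; rewrite lecE => /andP[/eqP].
rewrite (ipC x).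
have := Re0 (x + 'i *: y); rewrite bopD bopZ.
rewrite linearDl /= !linearDr /= !linearZl_LR /= !linearZr_LR /=.
move: (Re0 x) (Re0 y); rewrite /ip.
case: (inner (A x) x) (inner (A x) y) (inner (A y) x) (inner (A y) y).
move=> a1 b1 [a2 b2] [a3 b3] [a4 b4] /= -> ->; lra.
Qed.

End RealInner.

(** * Self-adjoint operators, Neumann series and the bottom of the spectrum *)

Lemma le0_eps (R : realType) (a c : R) :
  0 <= c -> (forall e, 0 < e -> a <= e * c) -> a <= 0.
Proof.
move=> c0 h; rewrite leNgt; apply/negP => a0.
have c1 : 0 < c + 1 by lra.
have := h (a / (c + 1)) (divr_gt0 a0 c1).
rewrite mulrAC ler_pdivlMr // ler_pM2l //; lra.
Qed.

Section SelfAdjoint.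
Context (R : realType) (H : hilbertType R).
Implicit Types (A B S T K : bop H) (x y z : H) (a b c d : R).

Lemma sa1 : sa (1 : bop H).
Proof. by move=> x y. Qed.

Lemma sa0 : sa (0 : bop H).
Proof. by move=> x y /=; rewrite !ipE. Qed.

Lemma saD A B : sa A -> sa B -> sa (A + B).
Proof. by move=> sA sB x y /=; rewrite !ipE sA sB. Qed.

Lemma saN A : sa A -> sa (- A).
Proof. by move=> sA x y /=; rewrite !ipE sA. Qed.

Lemma saB A B : sa A -> sa B -> sa (A - B).
Proof. by move=> sA sB; apply: saD => //; apply: saN. Qed.

Lemma saZ a A : sa A -> sa (a%:C *: A).
Proof. by move=> sA x y /=; rewrite !ipE sA. Qed.

Lemma sa_conj A B : sa A -> sa B -> sa (A * B * A).
Proof. by move=> sA sB x y /=; rewrite sA sB sA. Qed.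

Lemma sa_sum (I : Type) (r : seq I) (P : pred I) (F : I -> bop H) :
  (forall i, P i -> sa (F i)) -> sa (\sum_(i <- r | P i) F i).
Proof. by move=> sF; elim/big_ind: _ => //; [exact: sa0|exact: saD]. Qed.

Lemma saX A n : sa A -> sa (A ^+ n).
Proof.
move=> sA; elim: n => [|n ih]; first exact: sa1.
by move=> x y; rewrite {1}exprS exprSr /= sA ih.
Qed.

(** The quadratic polynomial t -> <S(x + ty), x + ty> is nonnegative, so its discriminant is not
    positive. The form may be degenerate, hence the separate case of a vanishing leading
    coefficient. *)
Lemma sa_CS S x y : sa S -> (forall z, 0 <= ip (S z) z) ->
  ip (S x) y ^+ 2 <= ip (S x) x * ip (S y) y.
Proof.
move=> sS S0; set b := ip _ y; set a := ip _ x; set c := ip _ y.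
have h t : 0 <= a + 2 * t * b + t ^+ 2 * c.
  have := S0 (x + t%:C *: y).
  rewrite bopD bopZ !ipE (sS y x) (ipC y) -/a -/b -/c.
  by rewrite (_ : _ + _ + _ = a + 2 * t * b + t ^+ 2 * c)//; ring.
have [c0|c0] := eqVneq c 0.
  have [->|b0] := eqVneq b 0; first by rewrite c0 mulr0 expr0n.
  have := h (- (a + 1) / (2 * b)).
  rewrite c0 mulr0 addr0.
  rewrite (_ : a + _ = -1); last by field.
  by move=> ?; exfalso; lra.
have cp : 0 < c by rewrite lt_neqAle eq_sym c0 S0.
have := h (- b / c).
rewrite (_ : _ + _ = (a * c - b ^+ 2) / c); last by field.
by rewrite pmulr_lge0 ?invr_gt0 // subr_ge0.
Qed.

Lemma ip_nm x y : ip x y <= nm x * nm y.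
Proof.
apply: le_trans (ler_norm _) _.
rewrite -(@ler_pXn2r _ 2) ?nnegrE ?mulr_ge0 ?nm_ge0 //.
rewrite exprMn !nm_sqr -normrX ger0_norm ?sqr_ge0 //.
by apply: (@sa_CS 1) => [|z]; [exact: sa1|exact: ip_ge0].
Qed.

Lemma abs_ip x y : `|ip x y| <= nm x * nm y.
Proof. by rewrite ler_norml ip_nm andbT lerNl -ipNl -(nmN x) ip_nm. Qed.

(** Converts the order bounds produced by spectral arguments into the operator-norm estimates that
    define the functional calculus. *)
Lemma order_norm A c : sa A -> 0 <= c ->
  (forall x, ip (A x) x <= c * ip x x) ->
  (forall x, - (c * ip x x) <= ip (A x) x) ->
  forall x, nm (A x) <= c * nm x.
Proof.
move=> sA c0 up lo x.
have [/nm_eq0 ->|x0] := eqVneq (nm x) 0; first by rewrite bop0 nm0 mulr0.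
have [->|Ax0] := eqVneq (nm (A x)) 0; first by rewrite mulr_ge0 ?nm_ge0.
have xp : 0 < nm x by rewrite lt_neqAle eq_sym x0 nm_ge0.
have Ap : 0 < nm (A x) by rewrite lt_neqAle eq_sym Ax0 nm_ge0.
(* polarization between [x] and the multiple of [A x] of the same norm *)
have [y yE] : {y | y = (nm x / nm (A x))%:C *: A x} by exists ((nm x / nm (A x))%:C *: A x).
have E1 : ip (A (x + y)) (x + y) - ip (A (x - y)) (x - y) = 4 * ip (A x) y.
  rewrite !bopD bopN !ipE (sA y x) (ipC y (A x)); ring.
have E2 : ip (x + y) (x + y) + ip (x - y) (x - y) = 2 * (ip x x + ip y y).
  by rewrite !ipE (ipC y x); ring.
have yn : ip y y = ip x x.
  by rewrite -!nm_sqr yE nmZ ger0_norm ?divr_ge0 ?nm_ge0 // divfK ?gt_eqF.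
have yA : ip (A x) y = nm x * nm (A x).
  by rewrite yE ipE -nm_sqr; field.
have h : nm x * nm (A x) <= c * nm x ^+ 2.
  have := up (x + y); have := lo (x - y).
  rewrite -yA nm_sqr; rewrite yn in E2.
  have : c * (ip (x + y) (x + y) + ip (x - y) (x - y)) = c * (2 * (ip x x + ip x x)) by rewrite E2.
  lra.
by rewrite -(ler_pM2l xp) (le_trans h) // expr2 mulrCA.
Qed.

(** Pointwise limits exist because [H] is complete; the Cauchy estimate is uniform in [x] and
    survives the limit, which yields both boundedness of the limit and convergence in norm. *)
Lemma bop_complete (T : nat -> bop H) :
  (forall e, 0 < e -> exists N, forall k l, (N <= k)%N -> (N <= l)%N ->
     forall x, nm ((T k - T l) x) <= e * nm x) ->
  exists S, forall e, 0 < e -> exists N, forall k, (N <= k)%N ->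
     forall x, nm ((T k - S) x) <= e * nm x.
Proof.
move=> cT.
have cv x : cvg (T ^~ x @ \oo).
  apply/cauchy_cvgP/cauchy_exP => e e0.
  have e0' : 0 < complex.Re e by move: e0; rewrite ltcE => /andP[].
  have eE : e = (complex.Re e)%:C by rewrite RRe_real // gtr0_real.
  have nx : 0 < nm x + 1 by have := nm_ge0 x; lra.
  have [N hN] := cT (complex.Re e / (nm x + 1)) (divr_gt0 e0' nx).
  exists (T N x); exists N => //= k /= Nk; rewrite -ball_normE /=.
  rewrite -nmE eE ltcR (le_lt_trans (hN N k (leqnn N) Nk x)) //.
  by rewrite mulrAC ltr_pdivrMr // ltr_pM2l //; lra.
pose S0 x := lim (T ^~ x @ \oo).
have est e x : 0 < e -> exists N, forall k, (N <= k)%N -> nm (S0 x - T k x) <= e.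
  move=> e0; have /cvgrPdist_le /(_ e%:C) := cv x.
  by rewrite ltcR => /(_ e0)[N _ hN]; exists N => k /hN; rewrite -nmE lecR.
have unif e : 0 < e -> exists N, forall k, (N <= k)%N ->
    forall x, nm (T k x - S0 x) <= e * nm x.
  move=> e0; have [N hN] := cT e e0; exists N => k Nk x.
  rewrite -subr_le0; apply: (@le0_eps _ _ 1) => // d d0; rewrite mulr1.
  have [N' hN'] := est d x d0; pose l := maxn N N'.
  have h1 := hN k l Nk (leq_maxl _ _) x; have h2 := hN' l (leq_maxr _ _).
  rewrite -nmN opprB in h2.
  have := nmD (T k x - T l x) (T l x - S0 x); rewrite addrA subrK.
  by move: h1; rewrite /=; lra.
have S0l : linear S0.
  move=> a x y; apply: cvg_lim => //.
  under eq_fun do rewrite bop_linear.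
  by apply: cvgD; [apply: cvgZr; exact: cv|exact: cv].
have bS : bounded_linear S0.
  split=> //; have [N hN] := unif 1 ltr01; have [M M0 hM] := bop_bound_nm (T N).
  exists (M + 1) => x; rewrite -le_nm mulrDl mul1r.
  have := hN N (leqnn N) x; rewrite mul1r.
  have := nmB (T N x) (T N x - S0 x); rewrite opprB addrC subrK.
  by have := hM x; lra.
by exists (mk_bop bS).
Qed.

Lemma nm_pow K r n x : 0 <= r -> (forall x, nm (K x) <= r * nm x) ->
  nm ((K ^+ n) x) <= r ^+ n * nm x.
Proof.
move=> r0 hK; elim: n => [|n ih]; first by rewrite expr0 mul1r.
rewrite !exprS /= -mulrA; apply: le_trans (hK _) _.
by rewrite ler_wpM2l.
Qed.

Lemma expr_small (r : R) : 0 <= r -> r < 1 -> forall e, 0 < e ->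
  exists N, forall k, (N <= k)%N -> r ^+ k <= e.
Proof.
move=> r0 r1 e e0.
have /cvgrPdist_le /(_ e e0)[N _ hN] : (fun k => r ^+ k) @ \oo --> 0.
  by apply: cvg_expr; rewrite ger0_norm.
by exists N => k /hN; rewrite sub0r normrN ger0_norm // exprn_ge0.
Qed.

Lemma neumann K r : 0 <= r -> r < 1 -> (forall x, nm (K x) <= r * nm x) ->
  op_invertible (1 - K).
Proof.
move=> r0 r1 hK; pose S n : bop H := \sum_(i < n) K ^+ i.
have r1' : 0 < 1 - r by lra.
have SS n : S n.+1 = S n + K ^+ n by rewrite /S big_ord_recr.
(* The constant is the geometric sum of [r ^+ i] over k <= i < k + d. *)
have Sd (k d : nat) x : nm ((S (k + d)%N - S k) x) <= (r ^+ k - r ^+ (k + d)) / (1 - r) * nm x.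
  elim: d => [|d ih]; first by rewrite addn0 !subrr mul0r mul0r /= nm0.
  rewrite addnS SS.
  have -> : (S (k + d)%N + K ^+ (k + d) - S k) = (S (k + d)%N - S k) + K ^+ (k + d).
    by rewrite addrAC.
  have -> : (r ^+ k - r ^+ (k + d).+1) / (1 - r) * nm x =
     (r ^+ k - r ^+ (k + d)) / (1 - r) * nm x + r ^+ (k + d) * nm x.
    by rewrite exprS; field; rewrite gt_eqF.
  apply: le_trans (nmD _ _) _; apply: lerD => //; exact: nm_pow.
have Sd' k l x : (k <= l)%N -> nm ((S l - S k) x) <= r ^+ k / (1 - r) * nm x.
  move=> /subnKC <-; apply: le_trans (Sd _ _ _) _.
  rewrite ler_wpM2r ?nm_ge0 // ler_wpM2r ?invr_ge0 ?(ltW r1') //.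
  by rewrite gerBl exprn_ge0.
have [T hT] : exists T, forall e, 0 < e -> exists N, forall k, (N <= k)%N ->
     forall x, nm ((S k - T) x) <= e * nm x.
  apply: bop_complete => e e0.
  have [N hN] := expr_small r0 r1 (mulr_gt0 e0 r1').
  exists N => k l Nk Nl x.
  wlog kl : k l Nk Nl / (k <= l)%N.
    move=> w; have [kl|/ltnW lk] := leqP k l; first exact: w.
    by rewrite -nmN -[- _]/((- (S k - S l)) x) opprB; exact: w.
  rewrite -nmN -[- _]/((- (S k - S l)) x) opprB.
  apply: le_trans (Sd' _ _ _ kl) _; rewrite ler_wpM2r ?nm_ge0 //.
  by rewrite ler_pdivrMr //; exact: hN.
have cancel (u v w : H) : v - u = - (u - w - v + w) by rewrite addrAC subrK opprB.
have tel n : (1 - K) * S n = 1 - K ^+ n /\ S n * (1 - K) = 1 - K ^+ n.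
  elim: n => [|n [ih1 ih2]]; first by rewrite /S big_ord0 mulr0 mul0r expr0 subrr.
  rewrite SS; split.
    by rewrite mulrDr ih1 mulrBl mul1r -exprS addrA subrK.
  by rewrite mulrDl ih2 mulrBr mulr1 -exprSr addrA subrK.
exists T; split; apply/bopP => x.
  apply/eqP; rewrite -subr_eq0; apply/eqP/nm_eq0/le_anti; rewrite nm_ge0 andbT.
  (* Two of the three units pay for [1 - K], of norm at most 2, composed with the error of [S n];
     the third pays for [K ^+ n]. *)
  apply: (@le0_eps _ _ (3 * nm x)); first by rewrite mulr_ge0 ?nm_ge0.
  move=> e e0; have [N1 hN1] := hT e e0; have [N2 hN2] := expr_small r0 r1 e0.
  pose n := maxn N1 N2.
  have h1 := hN1 n (leq_maxl _ _) x.
  have h2 : nm ((K ^+ n) x) <= e * nm x.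
    apply: le_trans (nm_pow _ _ r0 hK) _.
    by rewrite ler_wpM2r ?nm_ge0 // hN2 // leq_maxr.
  have -> : ((1 - K) * T) x - (1 : bop H) x = - ((1 - K) ((S n - T) x) + (K ^+ n) x).
    have := (tel n).1 => /(congr1 (fun B : bop H => B x)).
    rewrite -[((1 - K) * S n) x]/((1 - K) (S n x)) => E.
    rewrite (bopD (1 - K) (S n x)) E bopN.
    rewrite -[((1 - K) * T) x]/((1 - K) (T x)) -[(1 - K ^+ n) x]/(x - (K ^+ n) x).
    exact: cancel.
  rewrite nmN; apply: le_trans (nmD _ _) _.
  have h3 : nm ((1 - K) ((S n - T) x)) <= nm ((S n - T) x) + r * nm ((S n - T) x).
    by apply: le_trans (nmB _ _) _; rewrite lerD2l.
  have h4 : r * nm ((S n - T) x) <= nm ((S n - T) x).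
    by rewrite ler_piMl ?nm_ge0 // ltW.
  lra.
apply/eqP; rewrite -subr_eq0; apply/eqP/nm_eq0/le_anti; rewrite nm_ge0 andbT.
apply: (@le0_eps _ _ (3 * nm x)); first by rewrite mulr_ge0 ?nm_ge0.
move=> e e0; have [N1 hN1] := hT e e0; have [N2 hN2] := expr_small r0 r1 e0.
pose n := maxn N1 N2.
have h1 := hN1 n (leq_maxl _ _) ((1 - K) x).
have h2 : nm ((K ^+ n) x) <= e * nm x.
  apply: le_trans (nm_pow _ _ r0 hK) _.
  by rewrite ler_wpM2r ?nm_ge0 // hN2 // leq_maxr.
have -> : (T * (1 - K)) x - (1 : bop H) x = - ((S n - T) ((1 - K) x) + (K ^+ n) x).
  have := (tel n).2 => /(congr1 (fun B : bop H => B x)).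
  rewrite -[(S n * (1 - K)) x]/(S n ((1 - K) x)) => E.
  rewrite -[(S n - T) ((1 - K) x)]/(S n ((1 - K) x) - T ((1 - K) x)) E.
  rewrite -[(1 - K ^+ n) x]/(x - (K ^+ n) x).
  exact: cancel.
rewrite nmN; apply: le_trans (nmD _ _) _.
have h3 : nm ((1 - K) x) <= 2 * nm x.
  apply: le_trans (nmB _ _) _; rewrite mulr2n mulrDl mul1r lerD2l.
  by apply: le_trans (hK x) _; rewrite ler_piMl ?nm_ge0 // ltW.
have h4 : e * nm ((1 - K) x) <= e * (2 * nm x) by rewrite ler_pM2l.
lra.
Qed.

Lemma invertible_mul A B : op_invertible A -> op_invertible B -> op_invertible (A * B).
Proof.
move=> [A' [h1 h2]] [B' [h3 h4]]; exists (B' * A'); split.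
  by rewrite mulrA -(mulrA A) h3 mulr1.
by rewrite mulrA -(mulrA B') h2 mulr1.
Qed.

Lemma invertible_of_comm A B : A * B = B * A -> op_invertible (A * B) -> op_invertible A.
Proof.
move=> AB [C [h1 h2]]; exists (B * C).
have h3 : A * (B * C) = 1 by rewrite mulrA.
have h4 : C * B * A = 1 by rewrite -mulrA -AB.
have E : C * B = B * C by rewrite -[LHS]mulr1 -h3 mulrA h4 mul1r.
by split=> //; rewrite -E.
Qed.

Lemma invertibleZ (k : R[i]) A : k != 0 -> op_invertible A -> op_invertible (k *: A).
Proof.
move=> k0 [B [h1 h2]]; exists (k^-1 *: B).
split; apply/bopP => x /=.
  by rewrite bopZ scalerA mulfV // scale1r -[A (B x)]/((A * B) x) h1.
by rewrite bopZ scalerA mulVf // scale1r -[B (A x)]/((B * A) x) h2.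
Qed.

(** Divided by a large [N], the operator lies between d/N and 1, so 1 - S/N has norm at most 1 - d/N
    < 1 and the Neumann series applies. Adding [d] to the norm bound [M] ensures d <= N. *)
Lemma lb_invertible S d : sa S -> 0 < d ->
  (forall x, d * ip x x <= ip (S x) x) -> op_invertible S.
Proof.
move=> sS d0 lb; have [M M0 hM] := bop_bound_nm S.
pose N := M + d; have N0 : 0 < N by rewrite /N; lra.
have -> : S = N%:C *: (1 - (1 - N^-1%:C *: S)).
  apply/bopP => x /=; rewrite opprB addrCA subrr addr0 scalerA -rmorphM /=.
  by rewrite mulfV ?gt_eqF // scale1r.
apply: invertibleZ; first by rewrite -(rmorph0 (real_complex R)) (inj_eq (@complexI R)) gt_eqF.
have d1 : 0 <= 1 - d / N by rewrite subr_ge0 ler_pdivrMr // mul1r /N; lra.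
apply: (@neumann _ (1 - d / N)) => //; first by rewrite gtrBl divr_gt0.
apply: order_norm => //; first by apply: saB; [exact: sa1|exact: saZ].
  move=> x /=; rewrite !ipE mulrBl mul1r lerD2l lerN2 mulrAC mulrC.
  by rewrite ler_pM2l ?invr_gt0 // (ipC x).
move=> x /=; rewrite !ipE.
have h : N^-1 * ip (S x) x <= ip x x.
  rewrite mulrC ler_pdivrMr //; apply: le_trans (ip_nm _ _) _.
  apply: (@le_trans _ _ (M * nm x * nm x)); first by rewrite ler_wpM2r ?nm_ge0.
  rewrite -mulrA -expr2 nm_sqr mulrC ler_wpM2l ?ip_ge0 // /N; lra.
have := mulr_ge0 d1 (ip_ge0 x); lra.
Qed.

(** Cauchy-Schwarz for the form of [S], at [x] and [S x], gives |Sx|^2 <= M <Sx, x>, while the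
    inverse gives |x| <= N |Sx|; this avoids the square root of [S]. *)
Lemma invertible_lb S : sa S -> (forall x, 0 <= ip (S x) x) -> op_invertible S ->
  exists2 d, 0 < d & forall x, d * ip x x <= ip (S x) x.
Proof.
move=> sS S0 [T [_ TS]].
have [M M0 hM] := bop_bound_nm S; have [N N0 hN] := bop_bound_nm T.
exists (N ^+ 2 * M)^-1; first by rewrite invr_gt0 mulr_gt0 ?exprn_gt0.
move=> x; rewrite mulrC ler_pdivrMr ?mulr_gt0 ?exprn_gt0 //.
have h1 : nm (S x) ^+ 2 <= M * ip (S x) x.
  have [->|Sx] := eqVneq (nm (S x)) 0; first by rewrite expr0n mulr_ge0 // ltW.
  have Sp : 0 < nm (S x) ^+ 2 by rewrite exprn_gt0 // lt_neqAle eq_sym Sx nm_ge0.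
  have := sa_CS x (S x) sS S0; rewrite -nm_sqr => h.
  have h' : ip (S (S x)) (S x) <= M * nm (S x) ^+ 2.
    apply: le_trans (ip_nm _ _) _; rewrite expr2 mulrA.
    by rewrite ler_wpM2r ?nm_ge0.
  rewrite -(ler_pM2r Sp) -expr2; apply: le_trans h _.
  by rewrite -mulrA mulrCA ler_wpM2l.
have h2 : nm x ^+ 2 <= N ^+ 2 * nm (S x) ^+ 2.
  rewrite -exprMn ler_pXn2r ?nnegrE ?nm_ge0 ?mulr_ge0 ?nm_ge0 //; last exact: ltW.
  by have := hN (S x); rewrite -[T (S x)]/((T * S) x) TS.
rewrite -nm_sqr; apply: le_trans h2 _.
by apply: le_trans (ler_wpM2l (sqr_ge0 N) h1) _; rewrite mulrA mulrC.
Qed.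

(* The infimum of the quadratic form of [T] belongs to the spectrum, because an
   invertible nonnegative operator is bounded below by a positive constant. *)
Lemma spectrum_lb T c : sa T -> (forall l, l < c -> op_invertible (T - l%:C *: (1 : bop H))) ->
  forall x, c * ip x x <= ip (T x) x.
Proof.
move=> sT inv x0; rewrite leNgt; apply/negP => lt0.
have x0p : 0 < ip x0 x0.
  rewrite lt_neqAle ip_ge0 andbT eq_sym -nm_sqr expf_eq0 /=.
  by apply/eqP => /nm_eq0 x00; move: lt0; rewrite x00 bop0 !ipE mulr0 ltxx.
pose E := [set l : R | forall x, l * ip x x <= ip (T x) x].
have ubE : ubound E (ip (T x0) x0 / ip x0 x0) by move=> l /(_ x0); rewrite ler_pdivlMr.
have E0 : E !=set0.
  have [M M0 hM] := bop_bound_nm T; exists (- M) => x /=.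
  have := ip_nm (- T x) x; rewrite ipE nmN => h.
  have := ler_wpM2r (nm_ge0 x) (hM x); rewrite -mulrA -expr2 nm_sqr.
  lra.
have hs : has_sup E by split => //; exists (ip (T x0) x0 / ip x0 x0).
pose s := sup E.
have sc : s < c.
  by apply: le_lt_trans (ge_sup E0 ubE) _; rewrite ltr_pdivrMr.
have sE x : 0 <= ip ((T - s%:C *: (1 : bop H)) x) x.
  rewrite -oppr_le0; apply: (@le0_eps _ _ (ip x x)); first exact: ip_ge0.
  move=> e e0; have [l El] := sup_adherent e0 hs; rewrite -/s => sl.
  have := El x; rewrite /= !ipE => hl.
  have : (s - e) * ip x x <= l * ip x x by rewrite ler_wpM2r ?ip_ge0 // ltW.
  lra.
have sS : sa (T - s%:C *: (1 : bop H)) by apply: saB => //; apply: saZ; exact: sa1.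
have [d d0 hd] := invertible_lb sS sE (inv s sc).
have : E (s + d).
  by move=> x /=; have := hd x; rewrite /= !ipE; lra.
by move=> /(ub_le_sup (proj2 hs)); rewrite -/s; lra.
Qed.

End SelfAdjoint.

(** * Polynomial and continuous functional calculus *)

Section PolyCalculus.
Context (R : realType) (H : hilbertType R).
Implicit Types (A B S T : bop H) (x y z : H) (a b c d e t : R).

Lemma bop_scaleAl (k : R[i]) A B : (k *: A) * B = k *: (A * B).
Proof. by apply/bopP. Qed.

Lemma bop_scaleAr (k : R[i]) A B : A * (k *: B) = k *: (A * B).
Proof. by apply/bopP => x /=; rewrite bopZ. Qed.

(* Complex coefficients only serve to split real polynomials into linear factors. *)
Definition cpoly (p : {poly R[i]}) A : bop H := \sum_(i < size p) p`_i *: A ^+ i.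

Lemma cpolyE n (p : {poly R[i]}) A : (size p <= n)%N -> cpoly p A = \sum_(i < n) p`_i *: A ^+ i.
Proof.
move=> pn; rewrite /cpoly (big_ord_widen n (fun i => p`_i *: A ^+ i) pn) big_mkcond.
apply: eq_bigr => i _; case: ltnP => // pi.
by rewrite nth_default // scale0r.
Qed.

Lemma cpolyD (p q : {poly R[i]}) A : cpoly (p + q) A = cpoly p A + cpoly q A.
Proof.
pose n := maxn (size p) (size q).
rewrite (@cpolyE n) ?size_polyD // (@cpolyE n p) ?leq_maxl // (@cpolyE n q) ?leq_maxr //.
by rewrite -big_split; apply: eq_bigr => i _; rewrite coefD scalerDl.
Qed.

Lemma cpolyZ k (p : {poly R[i]}) A : cpoly (k *: p) A = k *: cpoly p A.
Proof.
rewrite (@cpolyE (size p)) ?size_scale_leq // /cpoly scaler_sumr.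
by apply: eq_bigr => i _; rewrite coefZ scalerA.
Qed.

Lemma cpolyMX (p : {poly R[i]}) A : cpoly (p * 'X) A = cpoly p A * A.
Proof.
rewrite (@cpolyE (size p).+1) ?size_polyMX_leq //; last first.
  by have [->|p0] := eqVneq p 0; rewrite ?mul0r ?size_poly0 // size_mulX.
rewrite big_ord_recl coefMX eqxx scale0r add0r /cpoly mulr_suml.
by apply: eq_bigr => i _; rewrite coefMX /= bop_scaleAl -exprSr.
Qed.

Lemma cpolyC k A : cpoly k%:P A = k *: (1 : bop H).
Proof. by rewrite (@cpolyE 1) ?size_polyC_leq1 // big_ord1 coefC expr0. Qed.

Lemma cpolyM (p q : {poly R[i]}) A : cpoly (p * q) A = cpoly p A * cpoly q A.
Proof.
elim/poly_ind: q p => [|q k ih] p.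
  by rewrite mulr0 /cpoly size_poly0 big_ord0 mulr0.
rewrite mulrDr mulrA !cpolyD !cpolyMX ih cpolyC mulrDr mulrA.
by rewrite (mulrC p) mul_polyC cpolyZ bop_scaleAr mulr1.
Qed.

Lemma op_polyE (p : {poly R}) A : op_poly p A = cpoly (map_poly (real_complex R) p) A.
Proof.
rewrite /cpoly size_map_poly /op_poly; apply: eq_bigr => i _.
by rewrite coef_map.
Qed.

Lemma op_polyD (p q : {poly R}) A : op_poly (p + q) A = op_poly p A + op_poly q A.
Proof. by rewrite !op_polyE rmorphD cpolyD. Qed.

Lemma op_polyM (p q : {poly R}) A : op_poly (p * q) A = op_poly p A * op_poly q A.
Proof. by rewrite !op_polyE rmorphM cpolyM. Qed.

Lemma op_polyZ c (p : {poly R}) A : op_poly (c *: p) A = c%:C *: op_poly p A.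
Proof. by rewrite !op_polyE linearZ cpolyZ. Qed.

Lemma op_polyC c A : op_poly c%:P A = c%:C *: (1 : bop H).
Proof. by rewrite !op_polyE map_polyC cpolyC. Qed.

Lemma op_polyX A : op_poly 'X A = A.
Proof. by rewrite -['X]mul1r op_polyE rmorphM /= map_polyX cpolyMX -op_polyE op_polyC scale1r mul1r. Qed.

Lemma op_polyN (p : {poly R}) A : op_poly (- p) A = - op_poly p A.
Proof. by rewrite -scaleN1r op_polyZ rmorphN1 scaleN1r. Qed.

Lemma sa_op_poly (p : {poly R}) A : sa A -> sa (op_poly p A).
Proof. by move=> sA; apply: sa_sum => i _; apply: saZ; apply: saX. Qed.

(** With B = A - a and J = ib, the commuting product (B - J)(B + J) equals B^2 + b^2, which is
    bounded below by b^2. *)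
Lemma nonreal_invertible A (k : R[i]) : sa A -> complex.Im k != 0 ->
  op_invertible (A - k *: (1 : bop H)).
Proof.
move=> sA; case: k => a b /= b0.
have [B BE] : {B | B = A - a%:C *: (1 : bop H)} by exists (A - a%:C *: (1 : bop H)).
have sB : sa B by rewrite BE; apply: saB => //; apply: saZ; exact: sa1.
have -> : A - (a +i* b) *: (1 : bop H) = B - (b%:C * 'i) *: (1 : bop H).
  rewrite BE -addrA -opprD -scalerDl; congr (A - _ *: _).
  by apply/eqP; rewrite eq_complex /=; apply/andP; split; apply/eqP; ring.
set J := _ *: (1 : bop H).
have BJ : B * J = J * B by rewrite bop_scaleAl bop_scaleAr mul1r mulr1.
have JJ : J * J = (- b ^+ 2)%:C *: (1 : bop H).
  rewrite bop_scaleAl bop_scaleAr mulr1 scalerA; congr (_ *: _).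
  by apply/eqP; rewrite eq_complex /=; apply/andP; split; apply/eqP; ring.
have E1 : (B - J) * (B + J) = B * B - J * J.
  by rewrite mulrBl !mulrDr opprD BJ addrA addrK.
have E2 : (B + J) * (B - J) = B * B - J * J.
  by rewrite mulrDl !mulrBr BJ addrA subrK.
apply: (@invertible_of_comm _ _ _ (B + J)); first by rewrite E1 E2.
rewrite E1 JJ; apply: (@lb_invertible _ _ _ (b ^+ 2)).
- by apply: saB; [move=> x y /=; rewrite -[LHS]/(ip (B (B x)) y) !sB|apply: saZ; exact: sa1].
- by rewrite exprn_even_gt0.
move=> x; rewrite -[(B * B - _) x]/(B (B x) - (- b ^+ 2)%:C *: x) !ipE sB mulNr opprK.
by rewrite lerDr ip_ge0.
Qed.

(** Over the complex numbers [q] splits into linear factors. A nonreal root gives an invertible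
    factor by self-adjointness, a real one because roots of [q] avoid the spectrum. *)
Lemma poly_invertible A (q : {poly R}) : sa A -> q != 0 ->
  (forall t, spectrum A t%:C -> q.[t] != 0) -> op_invertible (op_poly q A).
Proof.
move=> sA q0 hq; rewrite op_polyE; set Q := map_poly _ q.
have Q0 : Q != 0 by rewrite map_poly_eq0.
have [r Qr] := closed_field_poly_normal Q.
have rr k : k \in r -> root Q k.
  by move=> kr; rewrite Qr rootZ ?lead_coef_eq0 // root_prod_XsubC.
have rinv k : k \in r -> op_invertible (A - k *: (1 : bop H)).
  move=> /rr; case: k => a b /=; have [->|b0] := eqVneq b 0; last first.
    by move=> _; exact: nonreal_invertible.
  rewrite complexr0 /root horner_map fmorph_eq0 => qa.
  by apply: contrapT => /hq; rewrite qa.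
rewrite Qr cpolyZ; apply: invertibleZ; first by rewrite lead_coef_eq0.
elim: r rinv {Qr rr} => [_|k r ih rinv].
  by rewrite big_nil cpolyC scale1r; exists 1; rewrite mulr1.
rewrite big_cons cpolyM; apply: invertible_mul; last first.
  by apply: ih => j jr; apply: rinv; rewrite inE jr orbT.
rewrite -polyCN cpolyD cpolyC -['X]mul1r cpolyMX cpolyC scale1r mul1r scaleNr.
by apply: rinv; rewrite mem_head.
Qed.

Lemma spectrum_empty A : sa A -> (forall t, ~ spectrum A t%:C) -> forall x : H, x = 0.
Proof.
move=> sA sp0 x.
have h c : c * ip x x <= ip (A x) x.
  by apply: spectrum_lb => // l _; apply: contrapT; exact: sp0.
apply: nm_eq0; apply/eqP; rewrite -sqrf_eq0 nm_sqr eq_le ip_ge0 andbT leNgt.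
apply/negP => x0; have := h ((ip (A x) x + 1) / ip x x).
by rewrite divfK ?gt_eqF //; lra.
Qed.

Lemma poly_lb A (q : {poly R}) c : sa A -> (forall t, spectrum A t%:C -> c <= q.[t]) ->
  forall x, c * ip x x <= ip (op_poly q A x) x.
Proof.
move=> sA hq; apply: spectrum_lb; first exact: sa_op_poly.
move=> l lc; rewrite -(op_polyC l A) -op_polyN -op_polyD.
(* If [q] is the constant [l], which is below [c], the hypothesis on [q] forbids any real spectrum;
   then [H] is the zero space, where every operator is invertible. *)
have [E|q0] := eqVneq (q - l%:P) 0; last first.
  apply: poly_invertible => // t /hq ct.
  by rewrite !hornerE gt_eqF //; lra.
have H0 : forall x : H, x = 0.
  apply: (@spectrum_empty A) => // t /hq.
  by move/eqP: E; rewrite subr_eq0 => /eqP ->; rewrite hornerC; lra.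
by exists 0; split; apply/bopP => x; rewrite [LHS]H0 [RHS]H0.
Qed.

Lemma poly_norm A (q : {poly R}) e : sa A -> 0 <= e ->
  (forall t, spectrum A t%:C -> `|q.[t]| <= e) ->
  forall x, nm (op_poly q A x) <= e * nm x.
Proof.
move=> sA e0 hq; apply: order_norm => //; first exact: sa_op_poly.
  move=> x; have := @poly_lb A (- q) (- e) sA; rewrite op_polyN => /(_ _ x).
  rewrite /= ipNl mulNr lerN2; apply => t /hq; rewrite hornerN lerN2.
  by rewrite ler_norml => /andP[].
move=> x; rewrite -mulNr; apply: poly_lb => // t /hq.
by rewrite ler_norml => /andP[].
Qed.

Lemma spectrum_ge A a t : sa A -> (forall x, a * ip x x <= ip (A x) x) ->
  spectrum A t%:C -> a <= t.
Proof.
move=> sA lb; rewrite leNgt => h; apply/negP => ta; apply: h.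
apply: (@lb_invertible _ _ _ (a - t)); rewrite ?subr_gt0 //.
  by apply: saB => //; apply: saZ; exact: sa1.
by move=> x /=; rewrite !ipE; have := lb x; lra.
Qed.

Lemma spectrum_le A b t : sa A -> (forall x, ip (A x) x <= b * ip x x) ->
  spectrum A t%:C -> t <= b.
Proof.
move=> sA ub; rewrite leNgt => h; apply/negP => tb; apply: h.
have -> : A - t%:C *: (1 : bop H) = (-1) *: (t%:C *: (1 : bop H) - A).
  by rewrite scaleN1r opprB.
apply: invertibleZ; first by rewrite oppr_eq0 oner_eq0.
apply: (@lb_invertible _ _ _ (t - b)); rewrite ?subr_gt0 //.
  by apply: saB => //; apply: saZ; exact: sa1.
by move=> x /=; rewrite !ipE; have := ub x; lra.
Qed.

End PolyCalculus.

(** * Continuous functional calculus: uniqueness, order bounds, products, existence *)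

Section FunCalc.
Context (R : realType) (H : hilbertType R).
Implicit Types (A B S T : bop H) (x y z : H) (a b c d e t : R) (f g : R -> R).

Lemma is_fun_calc_nm f A T : is_fun_calc f A T <-> forall e, 0 < e ->
  exists p : {poly R}, (forall t, spectrum A t%:C -> `|p.[t] - f t| <= e) /\
    (forall x, nm ((op_poly p A - T) x) <= e * nm x).
Proof.
by split=> h e /h[p [hp hT]]; exists p; split=> // x; move: (hT x); rewrite le_nm.
Qed.

Lemma fc_poly (p : {poly R}) A : is_fun_calc (fun t => p.[t]) A (op_poly p A).
Proof.
apply/is_fun_calc_nm => e e0; exists p; split=> [t _|x].
  by rewrite subrr normr0 ltW.
by rewrite subrr /= nm0 mulr_ge0 ?nm_ge0 // ltW.
Qed.

Lemma fc_id A : is_fun_calc id A A.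
Proof.
have := fc_poly 'X A; rewrite op_polyX; congr is_fun_calc.
by apply/funext => t; rewrite hornerX.
Qed.

Lemma fc_cst c A : is_fun_calc (fun=> c) A (c%:C *: (1 : bop H)).
Proof.
have := fc_poly c%:P A; rewrite op_polyC; congr is_fun_calc.
by apply/funext => t; rewrite hornerC.
Qed.

Lemma fc_ext f g A T : (forall t, spectrum A t%:C -> f t = g t) ->
  is_fun_calc f A T -> is_fun_calc g A T.
Proof.
move=> fg h e /h[p [hp hT]]; exists p; split=> // t At.
by rewrite -fg //; exact: hp.
Qed.

Lemma fc_sa f A T : sa A -> is_fun_calc f A T -> sa T.
Proof.
move=> sA /is_fun_calc_nm hT x y; apply/eqP; rewrite -subr_eq0 -normr_le0.
apply: (@le0_eps _ _ (2 * (nm x * nm y))); first by rewrite !mulr_ge0 ?nm_ge0.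
move=> e e0; have [p [_ hp]] := hT e e0.
have -> : ip (T x) y - ip x (T y) =
    ip x ((op_poly p A - T) y) - ip ((op_poly p A - T) x) y.
  by rewrite /= !ipE (sa_op_poly p sA x y); ring.
have h1 : `|ip x ((op_poly p A - T) y)| <= e * (nm x * nm y).
  by rewrite mulrCA; apply: le_trans (abs_ip _ _) _; rewrite ler_wpM2l ?nm_ge0.
have h2 : `|ip ((op_poly p A - T) x) y| <= e * (nm x * nm y).
  by rewrite mulrA; apply: le_trans (abs_ip _ _) _; rewrite ler_wpM2r ?nm_ge0.
by apply: le_trans (ler_normB _ _) _; lra.
Qed.

Lemma fc_lb f A T c : sa A -> is_fun_calc f A T ->
  (forall t, spectrum A t%:C -> c <= f t) -> forall x, c * ip x x <= ip (T x) x.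
Proof.
move=> sA /is_fun_calc_nm hT cf x; rewrite -subr_le0.
apply: (@le0_eps _ _ (2 * ip x x)); first by rewrite mulr_ge0 ?ip_ge0.
move=> e e0; have [p [hp hpT]] := hT e e0.
have h1 : (c - e) * ip x x <= ip (op_poly p A x) x.
  apply: poly_lb => // t At; have := hp t At; have := cf t At.
  by rewrite ler_norml => ? /andP[]; lra.
have h2 : ip ((op_poly p A - T) x) x <= e * ip x x.
  apply: le_trans (ip_nm _ _) _; rewrite -nm_sqr expr2 mulrA.
  by rewrite ler_wpM2r ?nm_ge0.
by move: h1 h2; rewrite /= !ipE; lra.
Qed.

Lemma fc_lin f g A S T c : is_fun_calc f A S -> is_fun_calc g A T ->
  is_fun_calc (fun t => f t + c * g t) A (S + c%:C *: T).
Proof.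
move=> /is_fun_calc_nm hS /is_fun_calc_nm hT; apply/is_fun_calc_nm => e e0.
have k0 : 0 < 1 + `|c| by have := normr_ge0 c; lra.
have [p [hp hpS]] := hS _ (divr_gt0 e0 k0); have [q [hq hqT]] := hT _ (divr_gt0 e0 k0).
have eE : e = e / (1 + `|c|) + `|c| * (e / (1 + `|c|)) by field; rewrite gt_eqF.
exists (p + c *: q); split=> [t At|x].
  rewrite hornerD hornerZ opprD addrACA -mulrBr eE.
  apply: le_trans (ler_normD _ _) _; rewrite normrM lerD ?hp //.
  by rewrite ler_wpM2l ?hq.
rewrite op_polyD op_polyZ opprD addrACA -scalerBr.
apply: le_trans (nmD _ _) _; rewrite [X in _ <= X * _]eE mulrDl lerD ?hpS //=.
by rewrite nmZ -mulrA ler_wpM2l ?hqT.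
Qed.

Lemma fc_scale f A T c : is_fun_calc f A T -> is_fun_calc (fun t => c * f t) A (c%:C *: T).
Proof.
move=> hf; have := fc_lin c (fc_cst 0 A) hf; rewrite rmorph0 scale0r add0r.
by apply: fc_ext => t _; rewrite add0r.
Qed.

Lemma fc_ub f A T c : sa A -> is_fun_calc f A T ->
  (forall t, spectrum A t%:C -> f t <= c) -> forall x, ip (T x) x <= c * ip x x.
Proof.
move=> sA /(fc_scale (-1)) hT fc x.
have := fc_lb (c := - c) sA hT => /(_ _ x); rewrite /= ipZl !mulNr mul1r lerN2.
by apply=> t At; rewrite mulNr mul1r lerN2 fc.
Qed.

Lemma fc_norm f A T c : sa A -> is_fun_calc f A T -> 0 <= c ->
  (forall t, spectrum A t%:C -> `|f t| <= c) -> forall x, nm (T x) <= c * nm x.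
Proof.
move=> sA hT c0 fc; apply: order_norm => //; first exact: fc_sa hT.
  by apply: fc_ub hT _ => // t /fc; rewrite ler_norml => /andP[].
move=> x; rewrite -mulNr; apply: fc_lb hT _ _ => // t /fc.
by rewrite ler_norml => /andP[].
Qed.

Lemma fc_diff f g A S T e : sa A -> is_fun_calc f A S -> is_fun_calc g A T -> 0 <= e ->
  (forall t, spectrum A t%:C -> `|f t - g t| <= e) ->
  forall x, nm ((S - T) x) <= e * nm x.
Proof.
move=> sA hS hT e0 fg x.
have := fc_norm sA (fc_lin (-1) hS hT) e0; rewrite rmorphN1 scaleN1r; apply.
by move=> t /fg; rewrite mulN1r.
Qed.

Lemma fc_uniq f A S T : sa A -> is_fun_calc f A S -> is_fun_calc f A T -> S = T.
Proof.
move=> sA hS hT; apply/bopP => x; apply/eqP; rewrite -subr_eq0; apply/eqP/nm_eq0.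
apply/le_anti; rewrite nm_ge0 andbT.
have : forall t, spectrum A t%:C -> `|f t - f t| <= 0.
  by move=> t _; rewrite subrr normr0.
by move=> /(fc_diff sA hS hT (lexx 0))/(_ x); rewrite mul0r.
Qed.

Lemma fun_calcE f A T : sa A -> is_fun_calc f A T -> fun_calc f A = T.
Proof.
move=> sA hT; apply: xget_unique => // S hS; exact: fc_uniq hS hT.
Qed.

(** Boundedness on the spectrum is assumed because products of uniform approximations converge
    uniformly only when the factors stay bounded. *)
Lemma fc_mul f g A S T c : sa A -> 0 <= c ->
  (forall t, spectrum A t%:C -> `|f t| <= c) ->
  (forall t, spectrum A t%:C -> `|g t| <= c) ->
  is_fun_calc f A S -> is_fun_calc g A T -> is_fun_calc (fun t => f t * g t) A (S * T).
Proof.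
move=> sA c0 fc gc hS hT; apply/is_fun_calc_nm => e e0.
have k0 : 0 < 2 * c + 1 by lra.
pose d := Num.min 1 (e / (2 * c + 1)).
have d0 : 0 < d by rewrite lt_min ltr01 divr_gt0.
have d1 : d <= 1 by rewrite ge_min lexx.
have de : (c + d) * d + d * c <= e.
  apply: (@le_trans _ _ (d * (2 * c + 1))).
    have : d * d <= d * 1 by rewrite ler_wpM2l // ltW.
    lra.
  by rewrite -ler_pdivlMr // ge_min lexx orbT.
move/is_fun_calc_nm: (hS) => /(_ d d0)[p [hp hpS]].
move/is_fun_calc_nm: (hT) => /(_ d d0)[q [hq hqT]].
have pc t : spectrum A t%:C -> `|p.[t]| <= c + d.
  move=> At; rewrite -(subrK (f t) p.[t]) addrC.
  by apply: le_trans (ler_normD _ _) _; rewrite lerD ?fc ?hp.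
exists (p * q); split=> [t At|x].
  have -> : (p * q).[t] - f t * g t = p.[t] * (q.[t] - g t) + (p.[t] - f t) * g t.
    by rewrite hornerM; ring.
  apply: le_trans de; apply: le_trans (ler_normD _ _) _; rewrite !normrM.
  by apply: lerD; apply: ler_pM => //; [exact: pc|exact: hq|exact: hp|exact: gc].
have -> : op_poly (p * q) A - S * T =
    op_poly p A * (op_poly q A - T) + (op_poly p A - S) * T.
  by rewrite op_polyM mulrBr mulrBl addrA subrK.
apply: le_trans (ler_wpM2r (nm_ge0 x) de); rewrite [X in _ <= X]mulrDl.
apply: le_trans (nmD _ _) _; apply: lerD; rewrite -[X in _ <= X]mulrA.
  have := @poly_norm _ _ A p (c + d) sA _ pc ((op_poly q A - T) x).
  move=> /(_ (addr_ge0 c0 (ltW d0)))/le_trans; apply.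
  by apply: ler_wpM2l => //; exact: addr_ge0 (ltW d0).
apply: le_trans (hpS (T x)) _; apply: ler_wpM2l; first exact: ltW.
exact: fc_norm hT _ _ _.
Qed.

(** An eigenvalue lies in the spectrum, where the approximating polynomials are close to [f], and
    these act on [v] as scalars. This allows explicit evaluation in the concavity proof. *)
Lemma fc_eigen f A T t (v : H) : is_fun_calc f A T -> A v = t%:C *: v -> T v = (f t)%:C *: v.
Proof.
move=> /is_fun_calc_nm hT Av.
have [->|v0] := eqVneq v 0; first by rewrite bop0 scaler0.
have At : spectrum A t%:C.
  move=> [B [_ BA]]; move/eqP: v0; apply.
  have := congr1 (fun C : bop H => C v) BA.
  by rewrite -[LHS]/(B (A v - t%:C *: v)) Av subrr bop0.
have pv p : op_poly p A v = (p.[t])%:C *: v.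
  elim/poly_ind: p => [|p c ih].
    by rewrite /op_poly size_poly0 big_ord0 horner0 scale0r.
  rewrite op_polyD op_polyM op_polyX op_polyC /= Av bopZ ih scalerA -scalerDl.
  by rewrite !hornerE -rmorphM -rmorphD mulrC.
apply/eqP; rewrite -subr_eq0; apply/eqP/nm_eq0/le_anti; rewrite nm_ge0 andbT.
apply: (@le0_eps _ _ (2 * nm v)); first by rewrite mulr_ge0 ?nm_ge0.
move=> e e0; have [p [hp hpT]] := hT e e0.
have := hpT v; rewrite /= pv => h1.
have h2 : nm ((p.[t] - f t)%:C *: v) <= e * nm v by rewrite nmZ ler_wpM2r ?nm_ge0 ?hp.
have := nmB ((p.[t] - f t)%:C *: v) ((p.[t])%:C *: v - T v).
rewrite rmorphB scalerBl opprB addrC addrA subrK.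
by move: h2; rewrite rmorphB scalerBl; lra.
Qed.

Lemma fc_exists f A a b : sa A ->
  (forall x, a * ip x x <= ip (A x) x) -> (forall x, ip (A x) x <= b * ip x x) ->
  (forall e, 0 < e -> exists p : {poly R}, forall t, a <= t <= b -> `|p.[t] - f t| <= e) ->
  exists T, is_fun_calc f A T.
Proof.
move=> sA lb ub apx.
have spab t : spectrum A t%:C -> a <= t <= b.
  by move=> At; rewrite (spectrum_ge sA lb At) (spectrum_le sA ub At).
have /choice[p hp] : forall k : nat, exists p : {poly R},
    forall t, a <= t <= b -> `|p.[t] - f t| <= k.+1%:R^-1.
  by move=> k; apply: apx; rewrite invr_gt0.
have small e : 0 < e -> exists N, forall k, (N <= k)%N -> k.+1%:R^-1 <= e.
  move=> e0; have /cvgrPdist_le /(_ e e0)[N _ hN] := @cvg_harmonic R.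
  by exists N => k /hN; rewrite sub0r normrN /harmonic /= ger0_norm // invr_ge0.
have [T hT] : exists T, forall e, 0 < e -> exists N, forall k, (N <= k)%N ->
     forall x, nm ((op_poly (p k) A - T) x) <= e * nm x.
  apply: bop_complete => e e0; have e20 : 0 < e / 2 by lra.
  have [N hN] := small _ e20; exists N => k l Nk Nl x.
  rewrite -op_polyN -op_polyD; apply: poly_norm => //; first exact: ltW.
  move=> t /spab tab; rewrite hornerD hornerN.
  have -> : (p k).[t] - (p l).[t] = ((p k).[t] - f t) - ((p l).[t] - f t) by ring.
  apply: le_trans (ler_normB _ _) _.
  have := le_trans (hp k t tab) (hN k Nk); have := le_trans (hp l t tab) (hN l Nl); lra.
exists T; apply/is_fun_calc_nm => e e0.
have [N1 hN1] := small e e0; have [N2 hN2] := hT e e0; pose n := maxn N1 N2.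
exists (p n); split=> [t /spab tab|x].
  exact: le_trans (hp n t tab) (hN1 n (leq_maxl _ _)).
by apply: hN2; exact: leq_maxr.
Qed.

End FunCalc.

(** * Weierstrass approximation *)

Section Weierstrass.
Context (R : realType).
Implicit Types (f : R -> R) (g h : nat -> R) (a b c e s t x y C : R).

(** The form of uniform continuity suited to Bernstein polynomials: under the expectation the
    quadratic term becomes a variance. Near the diagonal continuity gives [e], away from it a large
    [C] dominates twice the maximum of |f|, and compactness makes [C] uniform. *)
Lemma quadratic_modulus f a b e : a <= b ->
  (forall t, a <= t <= b -> {for t, continuous f}) -> 0 < e ->
  exists2 C, 0 <= C & forall x y, a <= x <= b -> a <= y <= b ->
    `|f x - f y| <= e + C * (x - y) ^+ 2.
Proof.
move=> ab cf e0.
have cnf : {within `[a, b], continuous (fun t => `|f t|)}.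
  apply: continuous_in_subspaceT => t; rewrite inE /= in_itv /= => /cf ct.
  by apply: continuous_comp; [exact: ct|exact: norm_continuous].
have [t0 t0ab ft0] := EVT_max ab cnf; pose F := `|f t0|.
have Fb t : a <= t <= b -> `|f t| <= F by move=> tab; apply: ft0; rewrite in_itv.
have F0 : 0 <= F by exact: normr_ge0.
pose P C x := a <= x <= b -> forall y, a <= y <= b -> `|f x - f y| <= e + C * (x - y) ^+ 2.
have /compact_near_coveringP cov := @segment_compact R a b.
have : \forall C \near +oo, `[a, b]%classic `<=` P C.
  apply: cov => x; rewrite /= in_itv /= => xab.
  have e20 : 0 < e / 2 by lra.
  have := cf x xab => /cvgrPdist_le/(_ _ e20)/nbhs_ballP[d d0 /= hd].
  have {}d0 : 0 < d by exact: d0.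
  have d20 : 0 < d / 2 by lra.
  (* Half the continuity radius: a [y] at distance at least [d] from [x] is still at distance at
     least d/2 from every x' in this ball, so this threshold for [C] covers the oscillation bound
     2F. *)
  exists (ball x (d / 2), [set C | 2 * F / (d / 2) ^+ 2 < C]) => /=.
    split; first exact: nbhsx_ballx.
    by apply: nbhs_pinfty_gt; exact: num_real.
  move=> [x' C] /= []; rewrite -ball_normE /= => xx' hC x'ab y yab.
  have C0 : 0 <= C.
    by apply: le_trans (ltW hC); rewrite divr_ge0 ?sqr_ge0 // mulr_ge0.
  have x'f : `|f x - f x'| <= e / 2.
    by apply: hd; rewrite -ball_normE /=; apply: (lt_trans xx'); rewrite ltr_pdivrMr //; lra.
  have sq0 : 0 <= C * (x' - y) ^+ 2 by rewrite mulr_ge0 ?sqr_ge0.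
  have [xy|xy] := ltP `|x - y| d.
    have yf : `|f x - f y| <= e / 2 by apply: hd; rewrite -ball_normE.
    have -> : f x' - f y = (f x - f y) - (f x - f x') by ring.
    by apply: le_trans (ler_normB _ _) _; lra.
  have x'y : d / 2 <= `|x' - y|.
    have := ler_normD (x - x') (x' - y); rewrite addrA subrK; lra.
  have h1 : (d / 2) ^+ 2 <= (x' - y) ^+ 2.
    by rewrite -[X in _ <= X]real_normK ?num_real // ler_pXn2r ?nnegrE // ltW.
  have h2 : 2 * F <= C * (x' - y) ^+ 2.
    apply: (@le_trans _ _ (C * (d / 2) ^+ 2)); last by rewrite ler_wpM2l.
    by rewrite -ler_pdivrMr ?exprn_gt0 // ltW.
  have := Fb _ x'ab; have := Fb _ yab; have := ler_normB (f x') (f y); lra.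
move=> [C [_ hC]]; exists (Num.max 0 (C + 1)); first by rewrite le_max lexx.
move=> x y xab yab; apply: (hC _ _ x _ xab y yab); last by rewrite /= in_itv.
by rewrite lt_max; apply/orP; right; rewrite ltrDl.
Qed.

(* Bernstein polynomials by the recursion of Bernoulli trials: the expectation
   of [g] at the number of successes in [n] trials of success probability [u]. *)
Fixpoint bernstein (u : {poly R}) n g : {poly R} :=
  if n is n'.+1 then u * bernstein u n' (g \o succn) + (1 - u) * bernstein u n' g
  else (g 0%N)%:P.

Lemma bernsteinS u n g t : (bernstein u n.+1 g).[t] =
  u.[t] * (bernstein u n (g \o succn)).[t] + (1 - u.[t]) * (bernstein u n g).[t].
Proof. by rewrite /= !hornerE. Qed.

Lemma bernstein_le u n g h t : 0 <= u.[t] <= 1 ->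
  (forall k, (k <= n)%N -> g k <= h k) ->
  (bernstein u n g).[t] <= (bernstein u n h).[t].
Proof.
move=> /andP[u0 u1]; elim: n g h => [|n ih] g h gh.
  by rewrite /= !hornerC gh.
rewrite !bernsteinS lerD // ler_wpM2l ?subr_ge0 //; apply: ih => k kn; apply: gh => //.
exact: leqW.
Qed.

(** Squared bias plus variance n u (1 - u) of a binomial variable. [C] may be negative, which serves
    the lower bound. *)
Lemma bernstein_moment u n t a C c :
  (bernstein u n (fun k => a + C * (k%:R - c) ^+ 2)).[t] =
  a + C * ((n%:R * u.[t] - c) ^+ 2 + n%:R * u.[t] * (1 - u.[t])).
Proof.
elim: n c => [|n ih] c; first by rewrite /= hornerC; ring.
have E : (fun k => a + C * (k%:R - c) ^+ 2) \o succn =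
    (fun k : nat => a + C * (k%:R - (c - 1)) ^+ 2).
  by apply/funext => k /=; rewrite -[k.+1%:R]natr1; ring.
by rewrite bernsteinS E !ih -[n.+1%:R]natr1; ring.
Qed.

Theorem weierstrass f a b e : a < b ->
  (forall t, a <= t <= b -> {for t, continuous f}) -> 0 < e ->
  exists p : {poly R}, forall t, a <= t <= b -> `|p.[t] - f t| <= e.
Proof.
move=> ab cf e0; have ba : 0 < b - a by lra.
have e20 : 0 < e / 2 by lra.
have [C C0 hC] := quadratic_modulus (ltW ab) cf e20.
pose K := C * (b - a) ^+ 2.
have K0 : 0 <= K by rewrite mulr_ge0 ?sqr_ge0.
(* In the variable t the variance is at most (b - a)^2 / N, so this [N] keeps its contribution below
   e/2. *)
pose N := (Num.truncn (K / (e / 2))).+1.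
have NK : K / N%:R <= e / 2.
  rewrite ler_pdivrMr ?ltr0n // mulrC -ler_pdivrMr //; apply: ltW.
  by apply: truncnS_gt.
have N0 : 0 < N%:R :> R by rewrite ltr0n.
pose u : {poly R} := (b - a)^-1 *: ('X - a%:P).
pose nd k := a + (b - a) * (k%:R / N%:R).
exists (bernstein u N (f \o nd)) => t tab.
have ut : u.[t] = (t - a) / (b - a) by rewrite /u hornerZ hornerXsubC mulrC.
have u01 : 0 <= u.[t] <= 1.
  by rewrite ut ler_pdivrMr // mulr_ge0 ?invr_ge0 ?subr_ge0 ?(ltW ba) //=; lra.
have ndab k : (k <= N)%N -> a <= nd k <= b.
  move=> kN; have k0 : 0 <= k%:R / N%:R :> R by rewrite divr_ge0.
  have k1 : k%:R / N%:R <= 1 :> R by rewrite ler_pdivrMr // mul1r ler_nat.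
  have := mulr_ge0 (ltW ba) k0; have := ler_wpM2l (ltW ba) k1; rewrite /nd mulr1.
  by move=> h1 h2; apply/andP; split; lra.
have E k : C * (nd k - t) ^+ 2 = K / N%:R ^+ 2 * (k%:R - N%:R * u.[t]) ^+ 2.
  by rewrite /nd /K ut; field; rewrite !gt_eqF.
have M : K / N%:R ^+ 2 * (N%:R * u.[t] * (1 - u.[t])) <= e / 2.
  apply: le_trans NK; rewrite -[X in _ <= X]mulr1.
  have -> : K / N%:R ^+ 2 * (N%:R * u.[t] * (1 - u.[t])) =
      K / N%:R * (u.[t] * (1 - u.[t])) by field; rewrite gt_eqF.
  apply: ler_wpM2l; first by rewrite divr_ge0 // ltW.
  by case/andP: u01 => u0 u1; apply: mulr_ile1 => //; lra.
(* Centring the quadratic at the mean [N%:R * u.[t]] removes the bias; only the variance bounded in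
   [M] is left. *)
have up : (bernstein u N (f \o nd)).[t] <= f t + e.
  apply: (@le_trans _ _ (bernstein u N (fun k => (f t + e / 2) +
    K / N%:R ^+ 2 * (k%:R - N%:R * u.[t]) ^+ 2)).[t]).
    apply: bernstein_le => // k kN /=; rewrite -E.
    by have := hC _ _ (ndab k kN) tab; rewrite ler_norml => /andP[]; lra.
  by rewrite bernstein_moment subrr expr0n /= add0r; lra.
have lo : f t - e <= (bernstein u N (f \o nd)).[t].
  apply: (@le_trans _ _ (bernstein u N (fun k => (f t - e / 2) +
    (- (K / N%:R ^+ 2)) * (k%:R - N%:R * u.[t]) ^+ 2)).[t]); last first.
    apply: bernstein_le => // k kN /=; rewrite mulNr -E.
    by have := hC _ _ (ndab k kN) tab; rewrite ler_norml => /andP[]; lra.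
  by rewrite bernstein_moment subrr expr0n /= add0r mulNr; lra.
by rewrite ler_norml; apply/andP; split; lra.
Qed.

End Weierstrass.

(** * Powers and the Loewner-Heinz inequality *)

Section Powers.
Context (R : realType) (H : hilbertType R).
Implicit Types (A B S T : bop H) (x y z : H) (a b c d e t p q : R) (f g : R -> R).

(** A quantitative form of [op_gt0]: the constant [d] keeps the spectrum inside a compact interval
    of ]0, +oo[. *)
Definition spos A : Prop :=
  sa A /\ exists2 d, 0 < d & forall x, d * ip x x <= ip (A x) x.

Lemma op_gt0P A : op_gt0 A <-> spos A.
Proof.
split=> [[/op_ge0P[sA A0] iA]|[sA [d d0 hd]]].
  by split=> //; exact: invertible_lb.
split; last exact: lb_invertible hd.
by apply/op_ge0P; split=> // x; apply: le_trans (hd x); rewrite mulr_ge0 ?ip_ge0 // ltW.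
Qed.

Lemma sa_ub A : sa A -> exists2 b, 0 < b & forall x, ip (A x) x <= b * ip x x.
Proof.
move=> sA; have [b b0 hb] := bop_bound_nm A; exists b => // x.
apply: le_trans (ip_nm _ _) _; rewrite -nm_sqr expr2 mulrA.
by rewrite ler_wpM2r ?nm_ge0.
Qed.

Lemma spos_bounds A : spos A -> exists a b, [/\ 0 < a, a < b,
  forall x, a * ip x x <= ip (A x) x & forall x, ip (A x) x <= b * ip x x].
Proof.
move=> [sA [a a0 ha]]; have [b b0 hb] := sa_ub sA.
(* The sum makes the interval nondegenerate, as [weierstrass] requires, even for a scalar
   operator. *)
exists a, (a + b); split=> //; first by rewrite ltrDl.
move=> x; apply: le_trans (hb x) _; rewrite mulrDl lerDr mulr_ge0 ?ip_ge0 //; exact: ltW.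
Qed.

Lemma spos_spectrum A t : spos A -> spectrum A t%:C -> 0 < t.
Proof. by move=> [sA [a a0 ha]] /(spectrum_ge sA ha); exact: lt_le_trans. Qed.

Lemma spos_fc f A : spos A -> (forall t, 0 < t -> {for t, continuous f}) ->
  is_fun_calc f A (fun_calc f A).
Proof.
move=> pA cf; have [a [b [a0 ab lb ub]]] := spos_bounds pA.
have [T hT] : exists T, is_fun_calc f A T.
  apply: (fc_exists pA.1 lb ub) => e e0; apply: weierstrass => // t /andP[at_ _].
  by apply: cf; exact: lt_le_trans at_.
by rewrite (fun_calcE pA.1 hT).
Qed.

Lemma spos_bounded f A : spos A -> (forall t, 0 < t -> {for t, continuous f}) ->
  exists2 c, 0 <= c & forall t, spectrum A t%:C -> `|f t| <= c.
Proof.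
move=> pA cf; have [a [b [a0 ab lb ub]]] := spos_bounds pA.
have cnf : {within `[a, b], continuous (fun t => `|f t|)}.
  apply: continuous_in_subspaceT => t; rewrite inE /= in_itv /= => /andP[at_ _].
  apply: continuous_comp; last exact: norm_continuous.
  by apply: cf; exact: lt_le_trans at_.
have [t0 t0ab ft0] := EVT_max (ltW ab) cnf.
exists `|f t0| => // t At; apply: ft0; rewrite in_itv /=.
by rewrite (spectrum_ge pA.1 lb At) (spectrum_le pA.1 ub At).
Qed.

Lemma spos_fc_mul f g A : spos A -> (forall t, 0 < t -> {for t, continuous f}) ->
  (forall t, 0 < t -> {for t, continuous g}) ->
  fun_calc f A * fun_calc g A = fun_calc (fun t => f t * g t) A.
Proof.
move=> pA cf cg; have [c c0 fc] := spos_bounded pA cf; have [d d0 gd] := spos_bounded pA cg.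
apply/esym/(fun_calcE pA.1); apply: (@fc_mul _ _ _ _ _ _ _ (c + d)).
- exact: pA.1.
- exact: addr_ge0.
- by move=> t /fc/le_trans; apply; rewrite lerDl.
- by move=> t /gd/le_trans; apply; rewrite lerDr.
- exact: spos_fc.
- exact: spos_fc.
Qed.

Lemma powR_continuous_gt0 p t : 0 < t -> {for t, continuous (fun s : R => s `^ p)}.
Proof.
move=> t0; apply/differentiable_continuous/derivable1_diffP.
by apply: derivable_powR; rewrite in_itv /= t0.
Qed.

Lemma pow_fc A p : spos A -> is_fun_calc (fun t => t `^ p) A (op_pow A p).
Proof. by move=> pA; apply: spos_fc => // t; exact: powR_continuous_gt0. Qed.

Lemma powE f A p : spos A -> (forall t, 0 < t -> t `^ p = f t) ->
  fun_calc f A = op_pow A p.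
Proof.
move=> pA pf; apply: (fun_calcE pA.1); apply: fc_ext (pow_fc p pA) => t At.
by rewrite pf //; exact: spos_spectrum At.
Qed.

Lemma powD A p q : spos A -> op_pow A p * op_pow A q = op_pow A (p + q).
Proof.
move=> pA; rewrite /op_pow spos_fc_mul //; try by move=> t; exact: powR_continuous_gt0.
apply: powE => // t t0; rewrite powRD //; apply/implyP => _; exact: lt0r_neq0.
Qed.

Lemma pow1 A : spos A -> op_pow A 1 = A.
Proof.
move=> pA; rewrite -(@powE id) //; first exact: fun_calcE pA.1 (fc_id A).
by move=> t t0; rewrite powRr1 // ltW.
Qed.

Lemma pow0 A : spos A -> op_pow A 0 = 1.
Proof.
move=> pA; rewrite -(@powE (fun=> 1)) //; last by move=> t t0; rewrite powRr0.
by rewrite (fun_calcE pA.1 (fc_cst 1 A)) scale1r.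
Qed.

Lemma powNK A p : spos A -> op_pow A (- p) * op_pow A p = 1.
Proof. by move=> pA; rewrite powD // addNr pow0. Qed.

Lemma powKN A p : spos A -> op_pow A p * op_pow A (- p) = 1.
Proof. by move=> pA; rewrite powD // subrr pow0. Qed.

Lemma pow_invertible A p : spos A -> op_invertible (op_pow A p).
Proof. by move=> pA; exists (op_pow A (- p)); rewrite powKN ?powNK. Qed.

Lemma sa_pow A p : spos A -> sa (op_pow A p).
Proof. by move=> pA; exact: fc_sa pA.1 (pow_fc p pA). Qed.

Lemma pow_half A p x : spos A -> ip (op_pow A p x) x = nm (op_pow A (p / 2) x) ^+ 2.
Proof.
move=> pA; rewrite nm_sqr (sa_pow (p / 2) pA) ipC.
rewrite -[op_pow A (p / 2) (op_pow A _ x)]/((op_pow A (p / 2) * op_pow A (p / 2)) x).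
by rewrite powD // -splitr.
Qed.

Lemma pow_apply A p q x : spos A -> op_pow A p (op_pow A q x) = op_pow A (p + q) x.
Proof. by move=> pA; rewrite -powD. Qed.

Lemma comp_polyZX (k : R) (P : {poly R}) A :
  op_poly (P \Po (k *: 'X)) A = op_poly P (k%:C *: A).
Proof.
elim/poly_ind: P => [|P c ih]; first by rewrite comp_poly0 /op_poly size_poly0 !big_ord0.
rewrite comp_polyD comp_polyM comp_polyX comp_polyC !op_polyD !op_polyM ih.
by rewrite op_polyZ !op_polyX !op_polyC.
Qed.

Lemma fc_scale_arg f A T c : 0 < c -> is_fun_calc (fun t => f (c * t)) A T ->
  is_fun_calc f (c%:C *: A) T.
Proof.
move=> c0 /is_fun_calc_nm hT; apply/is_fun_calc_nm => e e0; have [P [hP hPT]] := hT e e0.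
have cC : c%:C != 0 by rewrite -(rmorph0 (real_complex R)) (inj_eq (@complexI R)) gt_eqF.
exists (P \Po (c^-1 *: 'X)); split=> [t At|x]; last first.
  by rewrite comp_polyZX scalerA -rmorphM /= mulVf ?gt_eqF // scale1r; exact: hPT.
rewrite horner_comp hornerZ hornerX -{2}(mulVKf (lt0r_neq0 c0) t); apply: hP => inv.
apply: At; have -> : c%:C *: A - t%:C *: (1 : bop H) =
    c%:C *: (A - (c^-1 * t)%:C *: (1 : bop H)).
  by rewrite scalerBr scalerA -rmorphM /= mulVKf // gt_eqF.
exact: invertibleZ.
Qed.

Lemma sposZ A c : 0 < c -> spos A -> spos (c%:C *: A).
Proof.
move=> c0 [sA [d d0 hd]]; split; first exact: saZ.
exists (c * d); first exact: mulr_gt0.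
by move=> x /=; rewrite ipE -mulrA ler_pM2l.
Qed.

Lemma powZ A c p : 0 < c -> spos A -> op_pow (c%:C *: A) p = (c `^ p)%:C *: op_pow A p.
Proof.
move=> c0 pA; apply: fun_calcE; first exact: saZ pA.1.
apply: fc_scale_arg => //; apply: fc_ext (fc_scale (c `^ p) (pow_fc p pA)).
by move=> t /(spos_spectrum pA) t0; rewrite powRM // ltW.
Qed.

Lemma fc_le f g A S T : sa A -> is_fun_calc f A S -> is_fun_calc g A T ->
  (forall t, spectrum A t%:C -> f t <= g t) -> forall x, ip (S x) x <= ip (T x) x.
Proof.
move=> sA hS hT fg x; have := fc_lb (c := 0) sA (fc_lin (-1) hT hS) => /(_ _ x).
rewrite mul0r /= !ipE mulN1r subr_ge0; apply => t /fg.
by rewrite mulN1r subr_ge0.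
Qed.

Lemma pow_contraction A B p : spos A -> spos B ->
  (forall x, ip (op_pow A p x) x <= ip (op_pow B p x) x) ->
  forall x, nm (op_pow A (p / 2) (op_pow B (- (p / 2)) x)) <= nm x.
Proof.
move=> pA pB le x; rewrite -(@ler_pXn2r _ 2) ?nnegrE ?nm_ge0 //.
rewrite -pow_half //; apply: le_trans (le _) _.
by rewrite pow_half // pow_apply // subrr pow0.
Qed.

(** The operator is the adjoint of the contraction T in [pow_contraction]; the bound follows from
    |T* x|^2 = <T T* x, x>. *)
Lemma pow_contraction_adj A B p : spos A -> spos B ->
  (forall x, ip (op_pow A p x) x <= ip (op_pow B p x) x) ->
  forall x, nm (op_pow B (- (p / 2)) (op_pow A (p / 2) x)) <= nm x.
Proof.
move=> pA pB le x; set u := op_pow B _ _.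
have [->|u0] := eqVneq (nm u) 0; first exact: nm_ge0.
have up : 0 < nm u by rewrite lt_neqAle eq_sym u0 nm_ge0.
rewrite -(ler_pM2l up) -expr2 nm_sqr {2}/u -(sa_pow _ pB) -(sa_pow _ pA).
apply: le_trans (ip_nm _ _) _; rewrite ler_wpM2r ?nm_ge0 //.
exact: pow_contraction.
Qed.

(* Pedersen: [Z] is similar to a product of two contractions, so its spectrum
   lies in (-oo, 1]. *)
Lemma pow_midpoint A B p q : spos A -> spos B ->
  (forall x, ip (op_pow A p x) x <= ip (op_pow B p x) x) ->
  (forall x, ip (op_pow A q x) x <= ip (op_pow B q x) x) ->
  forall x, ip (op_pow A ((p + q) / 2) x) x <= ip (op_pow B ((p + q) / 2) x) x.
Proof.
move=> pA pB lep leq x.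
pose s := (p + q) / 2; pose r := s / 2.
pose X := op_pow B (- (p / 2)) * op_pow A (p / 2) * (op_pow A (q / 2) * op_pow B (- (q / 2))).
have Xc y : nm (X y) <= nm y.
  apply: le_trans (pow_contraction_adj pA pB lep _) _.
  exact: pow_contraction.
pose Z := op_pow B (- r) * op_pow A s * op_pow B (- r).
(* The two outer factors are inverse to each other, so [Z] is similar to [X]. Similarity loses the
   norm bound but keeps invertibility of resolvents. *)
have ZX : Z = op_pow B (p / 2 - r) * X * op_pow B (r - p / 2).
  rewrite /Z /X !mulrA powD // -!mulrA powD // !mulrA -(mulrA _ (op_pow A (p / 2))) powD //.
  have -> : p / 2 - r - p / 2 = - r by lra.
  have -> : p / 2 + q / 2 = s by rewrite /s; lra.
  by have -> : - (q / 2) + (r - p / 2) = - r by rewrite /r /s; lra.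
have sZ : sa Z by apply: sa_conj; exact: sa_pow.
have Z1 y : ip (Z y) y <= ip y y.
  (* Up to similarity and the factor -l, this operator is 1 - (-1/l) X with 0 < -1/l < 1, hence a
     Neumann series. Self-adjointness of [Z] then turns the spectral bound into Z <= 1. *)
  have inv l : l < -1 -> op_invertible (- Z - l%:C *: (1 : bop H)).
    move=> l1; have l0 : l != 0 by apply/eqP; lra.
    have lC : l%:C != 0 by rewrite -(rmorph0 (real_complex R)) (inj_eq (@complexI R)).
    have invX : op_invertible (1 - (- l^-1)%:C *: X).
      have li : 0 <= - l^-1 by rewrite oppr_ge0 invr_le0; lra.
      have li1 : - l^-1 < 1.
        by rewrite -invrN invf_lt1; lra.
      apply: (@neumann _ _ _ (- l^-1)) => //.
      by move=> z; rewrite -[_ z]/((- l^-1)%:C *: X z) nmZ ger0_norm // ler_wpM2l.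
    have -> : - Z - l%:C *: (1 : bop H) =
        (- l%:C) *: (op_pow B (p / 2 - r) * (1 - (- l^-1)%:C *: X) * op_pow B (r - p / 2)).
      rewrite mulrBr mulr1 mulrBl powD // addrA subrK subrr pow0 //.
      rewrite bop_scaleAr bop_scaleAl -ZX scalerBr scalerA.
      rewrite scaleNr -rmorphN -rmorphM /= mulrNN mulfV // scale1r.
      by rewrite addrC.
    apply: invertibleZ; first by rewrite oppr_eq0.
    by apply: invertible_mul; [apply: invertible_mul => //|]; exact: pow_invertible.
  have := @spectrum_lb _ _ (- Z) (-1) (saN sZ) inv y.
  by rewrite /= ipE mulN1r lerN2.
have := Z1 (op_pow B r x).
rewrite -[Z (op_pow B r x)]/(op_pow B (- r) (op_pow A s (op_pow B (- r) (op_pow B r x)))).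
rewrite (sa_pow (- r) pB) pow_apply // addNr pow0 // -nm_sqr => h.
by rewrite (pow_half _ _ pB).
Qed.

(** k / 2^(n+1) is the midpoint of floor(k/2) / 2^n and ceil(k/2) / 2^n, so each level follows from
    the previous one by [pow_midpoint]. *)
Lemma pow_dyadic A B n k : spos A -> spos B -> (forall x, ip (A x) x <= ip (B x) x) ->
  (k <= 2 ^ n)%N ->
  forall x, ip (op_pow A (k%:R / 2 ^+ n) x) x <= ip (op_pow B (k%:R / 2 ^+ n) x) x.
Proof.
move=> pA pB le; elim: n k => [|n ih] k kn.
  case: k kn => [|[|//]] _ x; first by rewrite mul0r !pow0.
  by rewrite expr0 invr1 mulr1 !pow1.
have E : k%:R / 2 ^+ n.+1 = (k./2%:R / 2 ^+ n + (uphalf k)%:R / 2 ^+ n) / 2 :> R.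
  have Ek : (k./2 + uphalf k)%N = k by rewrite uphalf_half addnCA addnn odd_double_half.
  by rewrite -mulrDl -natrD Ek exprS; field; rewrite expf_neq0.
rewrite E; apply: pow_midpoint => //; apply: ih.
  by rewrite (leq_trans (half_leq kn)) // expnS mul2n doubleK.
by rewrite leq_uphalf_double -mul2n -expnS.
Qed.

Theorem loewner_heinz A B p : spos A -> spos B -> 0 <= p -> p <= 1 ->
  (forall x, ip (A x) x <= ip (B x) x) ->
  forall x, ip (op_pow A p x) x <= ip (op_pow B p x) x.
Proof.
move=> pA pB p0 p1 le x.
have [a [b [a0 ab lbA ubA]]] := spos_bounds pA.
have [c [d [c0 cd lbB ubB]]] := spos_bounds pB.
pose s := b + d + a^-1 + c^-1 + 1.
have ai : 0 < a^-1 by rewrite invr_gt0.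
have ci : 0 < c^-1 by rewrite invr_gt0.
have s1 : 1 <= s by rewrite /s; lra.
have sA t : spectrum A t%:C -> 0 < t /\ t <= s /\ 1 <= s * t.
  move=> At; have t1 := spectrum_ge pA.1 lbA At; have t2 := spectrum_le pA.1 ubA At.
  have sa_ : a^-1 <= s by rewrite /s; lra.
  split; first lra; split; first by rewrite /s; lra.
  by rewrite -(mulVf (lt0r_neq0 a0)); apply: ler_pM => //; exact: ltW.
have sB t : spectrum B t%:C -> 0 < t /\ t <= s /\ 1 <= s * t.
  move=> At; have t1 := spectrum_ge pB.1 lbB At; have t2 := spectrum_le pB.1 ubB At.
  have sc : c^-1 <= s by rewrite /s; lra.
  split; first lra; split; first by rewrite /s; lra.
  by rewrite -(mulVf (lt0r_neq0 c0)); apply: ler_pM => //; exact: ltW.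
have s0 : 0 < s by lra.
have Bx0 : 0 <= ip (op_pow B p x) x by rewrite pow_half // sqr_ge0.
rewrite -subr_le0; apply: (le0_eps Bx0) => e e0.
have l0 : 0 < ln (1 + e) by rewrite ln_gt0; lra.
have ls0 : 0 <= ln s by rewrite ln_ge0.
have half0 : 0 <= 2^-1 :> R by lra.
have half1 : 2^-1 < 1 :> R by lra.
(* [N] will satisfy 2^-N * 2 (ln s + 1) <= ln (1 + e); since p - q <= 2^-N, the two factors together
   cost at most 1 + e. *)
have den : 0 < 2 * (ln s + 1) by lra.
have [N hN] := expr_small half0 half1 (divr_gt0 l0 den).
(* On both spectra [s^-1 <= t <= s], so replacing the exponent [p] by the dyadic
   [q] costs a factor [s `^ (p - q)] for each of the two operators. *)
pose k := Num.truncn (p * 2 ^+ N).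
have tN : 0 < 2 ^+ N :> R by rewrite exprn_gt0.
have pN0 : 0 <= p * 2 ^+ N by rewrite mulr_ge0 // ltW.
have /andP[k1 k2] := truncn_itv pN0; rewrite -/k in k1 k2.
have kN : (k <= 2 ^ N)%N.
  rewrite -(ler_nat R) natrX; apply: le_trans k1 _.
  by rewrite ler_piMl // ltW.
pose q : R := k%:R / 2 ^+ N; pose h := p - q.
have h0 : 0 <= h by rewrite subr_ge0 /q ler_pdivrMr.
have hN2 : h <= (2^-1) ^+ N.
  have : p <= k.+1%:R / 2 ^+ N by rewrite ler_pdivlMr // ltW.
  by rewrite exprVn -natr1 mulrDl mul1r /h /q; lra.
have se : s `^ (h + h) <= 1 + e.
  rewrite /powR gt_eqF // -[X in _ <= X]lnK ?posrE; last lra.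
  rewrite ler_expR.
  have := le_trans hN2 (hN N (leqnn N)); rewrite ler_pdivlMr; last by lra.
  have := mulr_ge0 h0 ls0; lra.
have qA y : ip (op_pow A p y) y <= s `^ h * ip (op_pow A q y) y.
  rewrite -ipZl; apply: (fc_le pA.1 (pow_fc p pA) (fc_scale (s `^ h) (pow_fc q pA))).
  move=> t /sA[t0 [ts st]]; rewrite -(subrK q p) -/h (@powRD _ t h q);
    last by apply/implyP; rewrite lt0r_neq0.
  by rewrite ler_wpM2r ?powR_ge0 // ge0_ler_powR // nnegrE ltW.
have qB y : ip (op_pow B q y) y <= s `^ h * ip (op_pow B p y) y.
  rewrite -ipZl; apply: (fc_le pB.1 (pow_fc q pB) (fc_scale (s `^ h) (pow_fc p pB))).
  move=> t /sB[t0 [ts st]]; rewrite -(subrK q p) -/h (@powRD _ t h q);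
    last by apply/implyP; rewrite lt0r_neq0.
  rewrite mulrA ler_peMl ?powR_ge0 // -powRM ?(ltW t0) ?(ltW s0) //.
  have := @ge0_ler_powR R h h0 1 (s * t); rewrite powR1.
  by apply=> //; rewrite nnegrE ?ler01 ?mulr_ge0 ?(ltW s0) ?(ltW t0).
have := qA x; have := pow_dyadic pA pB le kN x; have := qB x; rewrite -/q => h1 h2 h3.
have h4 : ip (op_pow A p x) x <= s `^ (h + h) * ip (op_pow B p x) x.
  rewrite (@powRD _ s h h); last by apply/implyP; rewrite lt0r_neq0.
  rewrite -mulrA; apply: le_trans h3 _; rewrite ler_wpM2l ?powR_ge0 //.
  exact: le_trans h1.
have := ler_wpM2r Bx0 se; lra.
Qed.

End Powers.

(** * Hilbert sums *)

Section HilbertSum.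
Context (R : realType) (H : hilbertType R).

(** An alias of the product, whose own norm is the maximum of the components and in general comes
    from no inner product. *)
Definition hsum : Type := (H * H)%type.

HB.instance Definition _ := GRing.Lmodule.copy hsum (H * H)%type.

Implicit Types u v w : hsum.

(** The Euclidean combination of the two norms, written as a complex modulus so that the triangle
    inequality is inherited from the complex numbers. *)
Definition hsum_norm u : R[i] := `|nm u.1 +i* nm u.2|.

Lemma ler_normc (a b c d : R) : 0 <= a <= c -> 0 <= b <= d ->
  `|a +i* b| <= `|c +i* d|.
Proof.
move=> /andP[a0 ac] /andP[b0 bd]; have c0 := le_trans a0 ac; have d0 := le_trans b0 bd.
by rewrite !normc_def lecR /= ler_wsqrtr // lerD // ler_pXn2r ?nnegrE.
Qed.

Lemma hsum_normD u v : hsum_norm (u + v) <= hsum_norm u + hsum_norm v.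
Proof.
apply: le_trans (ler_normD _ _); rewrite /hsum_norm.
have -> : (nm u.1 +i* nm u.2) + (nm v.1 +i* nm v.2) =
  (nm u.1 + nm v.1) +i* (nm u.2 + nm v.2) by [].
by apply: ler_normc; rewrite nm_ge0 nmD.
Qed.

Lemma nmZC (k : R[i]) (x : H) : nm (k *: x) = nm (`|k| *: x).
Proof. by rewrite /nm !normrZ normr_id. Qed.

Lemma hsum_normZ (k : R[i]) u : hsum_norm (k *: u) = `|k| * hsum_norm u.
Proof.
rewrite /hsum_norm /= nmZC [nm (k *: u.2)]nmZC.
have [r r0 ->] : exists2 r : R, 0 <= r & `|k| = r%:C.
  by exists (complex.Re `|k|); rewrite ?RRe_real ?normr_real // -ler0c RRe_real ?normr_real.
rewrite !nmZ (ger0_norm r0).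
have -> : (r * nm u.1) +i* (r * nm u.2) = r%:C * (nm u.1 +i* nm u.2).
  by apply/eqP; rewrite eq_complex /= !mul0r subr0 addr0 !eqxx.
by rewrite normrM [`|r%:C|]ger0_norm ?ler0c.
Qed.

Lemma hsum_norm0_eq0 u : hsum_norm u = 0 -> u = 0.
Proof.
move=> /normr0_eq0/eqP; rewrite eq_complex /= => /andP[/eqP/nm_eq0 u1 /eqP/nm_eq0 u2].
by case: u u1 u2 => x y /= -> ->.
Qed.

HB.instance Definition _ := Lmodule_isNormed.Build R[i] hsum
  hsum_normD hsum_normZ hsum_norm0_eq0.

Lemma hsum_normE u : `|u| = `|nm u.1 +i* nm u.2|.
Proof. by []. Qed.

Lemma hsum_le1 u : `|u.1| <= `|u|.
Proof.
rewrite hsum_normE -(nmE u.1).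
rewrite (_ : (nm u.1)%:C = `|nm u.1 +i* 0|).
  by apply: ler_normc; rewrite ?lexx ?nm_ge0.
by rewrite normc_def /= expr0n addr0 sqrtr_sqr ger0_norm ?nm_ge0.
Qed.

Lemma hsum_le2 u : `|u.2| <= `|u|.
Proof.
rewrite hsum_normE -(nmE u.2).
rewrite (_ : (nm u.2)%:C = `|0 +i* nm u.2|).
  by apply: ler_normc; rewrite ?lexx ?nm_ge0.
by rewrite normc_def /= expr0n add0r sqrtr_sqr ger0_norm ?nm_ge0.
Qed.

Lemma hsum_le u : `|u| <= `|u.1| + `|u.2|.
Proof.
rewrite hsum_normE -(nmE u.1) -(nmE u.2) normc_def -rmorphD lecR /=.
rewrite -[X in _ <= X]ger0_norm ?addr_ge0 ?nm_ge0 // -sqrtr_sqr ler_wsqrtr //.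
by have := mulr_ge0 (nm_ge0 u.1) (nm_ge0 u.2); lra.
Qed.

Lemma hsum_complete (F : set_system hsum) : ProperFilter F -> cauchy F -> cvg F.
Proof.
move=> FF /cauchyP Fc.
have c1 : cvg (fst @ F : set_system H).
  apply/cauchy_cvgP/cauchyP => e /Fc[u Fu]; exists u.1.
  suff : F (fst @^-1` ball u.1 e) by [].
  apply: filterS Fu => v; rewrite -!ball_normE /=; apply: le_lt_trans.
  exact: (hsum_le1 (u - v)).
have c2 : cvg (snd @ F : set_system H).
  apply/cauchy_cvgP/cauchyP => e /Fc[u Fu]; exists u.2.
  suff : F (snd @^-1` ball u.2 e) by [].
  apply: filterS Fu => v; rewrite -!ball_normE /=; apply: le_lt_trans.
  exact: (hsum_le2 (u - v)).
apply/cvg_ex; exists ((lim (fst @ F : set_system H), lim (snd @ F : set_system H)) : hsum).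
apply/cvgrPdist_lt => e e0; have e20 : 0 < e / 2 by rewrite divr_gt0.
move/cvgrPdist_lt : c1 => /(_ _ e20) h1; move/cvgrPdist_lt : c2 => /(_ _ e20) h2.
apply: filterS2 h1 h2 => u h1 h2; apply: le_lt_trans (hsum_le _) _.
by rewrite [e]splitr ltrD.
Qed.

HB.instance Definition _ := Uniform_isComplete.Build hsum hsum_complete.

Definition hsum_inner u v : R[i] := inner u.1 v.1 + inner u.2 v.2.

Lemma hsum_inner_bilinear :
  bilinear_for *%R (Num.conj \; *%R) hsum_inner.
Proof.
split=> w k u v; rewrite /hsum_inner /=.
  by rewrite !linearPl /= mulrDr addrACA.
by rewrite !linearPr /= mulrDr addrACA.
Qed.

HB.instance Definition _ := bilinear_isBilinear.Build R[i] hsum hsum R[i]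
  *%R (Num.conj \; *%R) hsum_inner hsum_inner_bilinear.

Lemma hsum_inner_herm u v : hsum_inner u v = (-1) ^+ false * Num.conj (hsum_inner v u).
Proof.
by rewrite expr0 mul1r /hsum_inner rmorphD /= {1}(innerC u.1) (innerC u.2).
Qed.

HB.instance Definition _ := isHermitianSesquilinear.Build R[i] hsum false
  Num.conj hsum_inner hsum_inner_herm.

Lemma hsum_inner_normE u : hsum_inner u u = `|u| ^+ 2.
Proof.
rewrite /hsum_inner !inner_normE hsum_normE -add_Re2_Im2 /= rmorphD !rmorphXn /=.
by rewrite !nmE.
Qed.

Lemma hsum_inner_gt0 u : u != 0 -> 0 < hsum_inner u u.
Proof. by move=> u0; rewrite hsum_inner_normE exprn_gt0 // normr_gt0. Qed.

HB.instance Definition _ := isDotProduct.Build R[i] hsum hsum_inner hsum_inner_gt0.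

HB.instance Definition _ := CompleteNormedModule_isHilbert.Build R hsum
  hsum_inner_normE.

End HilbertSum.

(** * Operator monotone functions are concave *)

Section RankOne.
Context (R : realType) (H : hilbertType R).
Implicit Types (A B : bop H) (e x y z : H) (a b c t : R) (k : R[i]).

(** Splits a complex multiple into two real ones, so that projections can be treated with [ip]
    alone. *)
Lemma innerE y e : inner y e *: e = (ip y e)%:C *: e + (ip y ('i *: e))%:C *: ('i *: e).
Proof.
rewrite scalerA -scalerDl -Im_inner /ip; congr (_ *: _).
by rewrite {1}[inner y e]complexE mulrC.
Qed.

Lemma proj_bounded_linear e : bounded_linear (fun y => inner y e *: e).
Proof.
split=> [k x y|]; first by rewrite linearPl /= scalerDl scalerA.
exists (nm e * nm e + nm ('i *: e) * nm ('i *: e)) => y; rewrite -le_nm innerE.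
apply: le_trans (nmD _ _) _; rewrite !nmZ mulrDl.
have h z : `|ip y z| * nm z <= nm z * nm z * nm y.
  by rewrite [X in _ <= X]mulrC mulrA ler_wpM2r ?nm_ge0 // abs_ip.
by apply: lerD; exact: h.
Qed.

Definition proj e : bop H := mk_bop (proj_bounded_linear e).

Lemma sa_proj e : sa (proj e).
Proof. by move=> x y /=; rewrite !innerE !ipE (ipC e y) (ipC ('i *: e) y); ring. Qed.

Lemma proj_id e : inner e e = 1 -> proj e e = e.
Proof. by move=> e1 /=; rewrite e1 scale1r. Qed.

Lemma proj_idem e y : inner e e = 1 -> proj e (proj e y) = proj e y.
Proof. by move=> e1 /=; rewrite linearZl_LR /= e1 mulr1. Qed.

Lemma proj_ge0 e y : inner e e = 1 -> 0 <= ip (proj e y) y.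
Proof.
move=> e1; rewrite -(proj_idem y e1) sa_proj; exact: ip_ge0.
Qed.

Lemma proj_le e y : inner e e = 1 -> ip (proj e y) y <= ip y y.
Proof.
move=> e1; have := ip_ge0 (y - proj e y); rewrite !ipE (sa_proj e y (proj e y)).
rewrite proj_idem // (ipC y (proj e y)); lra.
Qed.

Definition diag e a b : bop H := b%:C *: (1 : bop H) + (a - b)%:C *: proj e.

Lemma diag_eigen e a b : inner e e = 1 -> diag e a b e = a%:C *: e.
Proof.
move=> e1; rewrite -[LHS]/(b%:C *: e + (a - b)%:C *: proj e e) proj_id //.
by rewrite -scalerDl -rmorphD /= addrC subrK.
Qed.

Lemma diag_orth e e' a b : inner e' e = 0 -> diag e a b e' = b%:C *: e'.
Proof. by move=> e0 /=; rewrite e0 scale0r scaler0 addr0. Qed.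

Lemma sa_diag e a b : sa (diag e a b).
Proof. by apply: saD; apply: saZ; [exact: sa1|exact: sa_proj]. Qed.

Lemma ip_diag e a b y : ip (diag e a b y) y = b * (ip y y - ip (proj e y) y) + a * ip (proj e y) y.
Proof.
rewrite -[diag e a b y]/(b%:C *: y + (a - b)%:C *: proj e y).
by rewrite ipDl !ipZl; ring.
Qed.

Lemma spos_diag e a b : inner e e = 1 -> 0 < a -> 0 < b -> spos (diag e a b).
Proof.
move=> e1 a0 b0; split; first exact: sa_diag.
exists (Num.min a b); first by rewrite lt_min a0.
move=> y; rewrite ip_diag; set q := ip (proj e y) y.
have q0 : 0 <= q by exact: proj_ge0.
have q1 : 0 <= ip y y - q by rewrite subr_ge0; exact: proj_le.
have ma : Num.min a b <= a by rewrite ge_min lexx.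
have mb : Num.min a b <= b by rewrite ge_min lexx orbT.
have := ler_wpM2r q0 ma; have := ler_wpM2r q1 mb; lra.
Qed.

(** Split y = u + w along [x] and its orthogonal complement. The cross term is absorbed by [eps] on
    the line and N^2/eps on the complement, where the remaining [N] bounds the block of [A]. *)
Lemma diag_dominates A x eps : sa A -> inner x x = 1 -> 0 < eps ->
  exists2 D, 0 < D & forall y, ip (A y) y <= ip (diag x (ip (A x) x + eps) D y) y.
Proof.
move=> sA x1 e0; have [N N0 hN] := bop_bound_nm A.
exists (N + N ^+ 2 / eps); first by rewrite addr_gt0 // divr_gt0 // exprn_gt0.
move=> y; rewrite ip_diag.
have [u uE] : {u | u = proj x y} by exists (proj x y).
have [w wE] : {w | w = y - u} by exists (y - u).
have yE : y = u + w by rewrite wE addrC subrK.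
have pu : proj x u = u by rewrite uE proj_idem.
have uw : ip u w = 0.
  by rewrite wE ipE ipNr -{1}pu sa_proj -uE subrr.
have -> : ip (proj x y) y = ip u u by rewrite -uE yE ipDr uw addr0.
have -> : ip y y - ip u u = ip w w by rewrite yE !ipE (ipC w) uw; ring.
have Au : ip (A u) u = ip (A x) x * ip u u.
  have -> : u = inner y x *: x by rewrite uE.
  rewrite bopZ /ip !linearZl_LR /= !linearZr_LR /= x1.
  by case: (inner y x) (inner (A x) x) => [a b] [c d] /=; ring.
have Aw : ip (A w) w <= N * ip w w.
  apply: le_trans (ip_nm _ _) _; rewrite -nm_sqr expr2 mulrA.
  by rewrite ler_wpM2r ?nm_ge0.
have Auw : 2 * ip (A u) w <= eps * ip u u + N ^+ 2 / eps * ip w w.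
  have h : ip (A u) w <= N * nm u * nm w.
    by apply: le_trans (ip_nm _ _) _; rewrite ler_wpM2r ?nm_ge0.
  (* AM-GM: [2 N |u| |w| <= eps |u|^2 + N^2 / eps |w|^2] *)
  rewrite -!nm_sqr.
  have : 0 <= eps^-1 * (eps * nm u - N * nm w) ^+ 2.
    by rewrite mulr_ge0 ?sqr_ge0 // invr_ge0 ltW.
  have -> : eps^-1 * (eps * nm u - N * nm w) ^+ 2 =
     eps * nm u ^+ 2 + N ^+ 2 / eps * nm w ^+ 2 - 2 * (N * nm u * nm w).
    by field; rewrite gt_eqF.
  lra.
rewrite {1 2}yE bopD !ipE (sA w u) (ipC w) Au; lra.
Qed.

End RankOne.

(** At the unit vector x = sqrt(l) e1 + sqrt(1 - l) e2 the form of f(A) is the left-hand side. As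
    [x] is an eigenvector of the dominating operator, the right-hand side does not see [D], which
    blows up as [eps] tends to 0. *)
Lemma operator_monotone_concave_eps (R : realType) (H : hilbertType R) (f : R -> R)
    (e1 e2 : H) (a b l eps : R) :
  operator_monotone f -> inner e1 e1 = 1 -> inner e2 e2 = 1 -> inner e1 e2 = 0 ->
  0 < a -> 0 < b -> 0 <= l <= 1 -> 0 < eps ->
  l * f a + (1 - l) * f b <= f (l * a + (1 - l) * b + eps).
Proof.
move=> [cf mf] e11 e22 e12 a0 b0 /andP[l0 l1] eps0.
have l1' : 0 <= 1 - l by lra.
have e21 : inner e2 e1 = 0 by rewrite innerC e12 conjc0.
pose A := diag e1 a b.
pose x := (Num.sqrt l)%:C *: e1 + (Num.sqrt (1 - l))%:C *: e2.
have sql : Num.sqrt l * Num.sqrt l = l by rewrite -expr2 sqr_sqrtr.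
have sql' : Num.sqrt (1 - l) * Num.sqrt (1 - l) = 1 - l by rewrite -expr2 sqr_sqrtr.
have comb c d : ip ((Num.sqrt l)%:C *: (c%:C *: e1) + (Num.sqrt (1 - l))%:C *: (d%:C *: e2)) x
    = l * c + (1 - l) * d.
  have -> : l * c + (1 - l) * d = Num.sqrt l * Num.sqrt l * c +
    Num.sqrt (1 - l) * Num.sqrt (1 - l) * d by rewrite sql sql'.
  by rewrite /x !ipE /ip e11 e22 e12 e21 /=; ring.
have x1 : inner x x = 1.
  have h : ip x x = 1.
    by have := comb 1 1; rewrite !scale1r -/x => ->; ring.
  apply/eqP; rewrite eq_complex -[complex.Re _]/(ip x x) h eqxx /= inner_normE.
  by rewrite -nmE -rmorphXn.
have pA : spos A by exact: spos_diag.
have Ae1 : A e1 = a%:C *: e1 by exact: diag_eigen.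
have Ae2 : A e2 = b%:C *: e2 by exact: diag_orth.
have Ax : ip (A x) x = l * a + (1 - l) * b.
  by rewrite {1}/x bopD !bopZ Ae1 Ae2 comb.
have [D D0 hD] := diag_dominates pA.1 x1 eps0.
rewrite Ax in hD; set c := _ + eps in hD *.
have c0 : 0 < c.
  have := mulr_ge0 l0 (ltW a0); have := mulr_ge0 l1' (ltW b0); rewrite /c; lra.
have pB : spos (diag x c D) by exact: spos_diag.
have AB : op_le A (diag x c D).
  apply/op_ge0P; split; first by apply: saB; [exact: pB.1|exact: pA.1].
  by move=> y; rewrite -[(_ - A) y]/(diag x c D y - A y) ipE ipNl subr_ge0.
have := mf H A (diag x c D) ((op_gt0P _).2 pA) ((op_gt0P _).2 pB) AB.
move=> /op_ge0P[_ /(_ x)].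
rewrite -[X in ip X x]/(fun_calc f (diag x c D) x - fun_calc f A x) ipDl ipNl subr_ge0.
have fA := spos_fc pA cf; have fB := spos_fc pB cf.
rewrite (fc_eigen fB (diag_eigen _ _ x1)) ipZl.
rewrite {1}/x bopD !bopZ (fc_eigen fA Ae1) (fc_eigen fA Ae2) comb.
by rewrite /ip x1 /= mulr1.
Qed.

(** Continuity removes [eps]. One nonzero vector is enough, since operator monotonicity is available
    on every Hilbert space, in particular on [hsum H]. *)
Lemma operator_monotone_concave (R : realType) (H : hilbertType R) (x0 : H) (f : R -> R)
    (a b l : R) : x0 != 0 -> operator_monotone f ->
  0 < a -> 0 < b -> 0 <= l <= 1 ->
  l * f a + (1 - l) * f b <= f (l * a + (1 - l) * b).
Proof.
move=> x00 mf a0 b0 l01.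
pose e : H := (nm x0)^-1%:C *: x0.
have n0 : 0 < nm x0.
  by rewrite lt_neqAle nm_ge0 eq_sym andbT; apply/eqP => /nm_eq0/eqP; rewrite (negbTE x00).
have e1 : inner e e = 1.
  by rewrite inner_normE -nmE nmZ ger0_norm ?invr_ge0 ?nm_ge0 // mulVf ?gt_eqF // expr1n.
pose e1' : hsum H := (e, 0); pose e2' : hsum H := (0, e).
have h1 : inner e1' e1' = 1.
  by rewrite -[LHS]/(inner e e + inner (0 : H) 0) e1 linear0l addr0.
have h2 : inner e2' e2' = 1.
  by rewrite -[LHS]/(inner (0 : H) 0 + inner e e) e1 linear0l add0r.
have h12 : inner e1' e2' = 0.
  by rewrite -[LHS]/(inner e 0 + inner 0 e) linear0l linear0r addr0.
have c0 : 0 < l * a + (1 - l) * b.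
  case/andP: l01; rewrite le_eqVlt => /predU1P[<- _|l0 l1]; first by rewrite mul0r subr0 mul1r add0r.
  by rewrite ltr_pwDl ?mulr_gt0 // mulr_ge0 ?subr_ge0 // ltW.
rewrite -subr_le0; apply: (@le0_eps _ _ 1) => // d d0; rewrite mulr1.
have /cvgrPdist_le/(_ d d0)/nbhs_ballP[r /= r0 hr] := mf.1 _ c0.
have {}r0 : 0 < r by exact: r0.
have r20 : 0 < r / 2 by lra.
have := operator_monotone_concave_eps mf h1 h2 h12 a0 b0 l01 r20.
have := hr (l * a + (1 - l) * b + r / 2).
rewrite -ball_normE /= opprD addNKr normrN gtr0_norm // ltr_pdivrMr // => /(_ ltac:(lra)).
by rewrite ler_norml => /andP[]; lra.
Qed.

(** * Operator means *)

Section Concave.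
Context (R : realType) (f : R -> R).
Context (concf : forall a b l, 0 < a -> 0 < b -> 0 <= l <= 1 ->
  l * f a + (1 - l) * f b <= f (l * a + (1 - l) * b)).

Lemma concave_chord a b t : 0 < a -> a < b -> a <= t <= b ->
  chord_slope f a b * t + chord_icpt f a b <= f t.
Proof.
move=> a0 ab /andP[at_ tb]; have b0 := lt_trans a0 ab.
have ba : 0 < b - a by lra.
pose l := (b - t) / (b - a).
have l01 : 0 <= l <= 1.
  by rewrite /l ler_pdivrMr // divr_ge0 ?subr_ge0 ?(ltW ab) //=; lra.
have := concf a0 b0 l01.
have -> : l * a + (1 - l) * b = t by rewrite /l; field; rewrite gt_eqF.
apply: le_trans; rewrite le_eqVlt; apply/orP; left; apply/eqP.
by rewrite /chord_slope /chord_icpt /l; field; rewrite gt_eqF.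
Qed.

(** The slope is the supremum of the chord slopes to the right of [c]; concavity bounds each of them
    by every chord slope to the left. *)
Lemma concave_support a b c : 0 < a -> a < c -> c < b ->
  exists k, forall t, a <= t <= b -> f t <= f c + k * (t - c).
Proof.
move=> a0 ac cb; pose E := [set (f t - f c) / (t - c) | t in [set t | c < t <= b]].
have three s t : a <= s < c -> c < t <= b ->
    (f t - f c) / (t - c) <= (f c - f s) / (c - s).
  move=> /andP[as_ sc] /andP[ct tb].
  have s0 : 0 < s by lra. have t0 : 0 < t by lra.
  pose l := (t - c) / (t - s).
  have ts : 0 < t - s by lra.
  have l01 : 0 <= l <= 1 by rewrite /l ler_pdivrMr // divr_ge0 ?(ltW ts) //=; lra.
  have := concf s0 t0 l01.
  have -> : l * s + (1 - l) * t = c by rewrite /l; field; rewrite gt_eqF.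
  have -> : l * f s + (1 - l) * f t = ((t - c) * f s + (c - s) * f t) / (t - s).
    by rewrite /l; field; rewrite gt_eqF.
  have tc : 0 < t - c by lra. have cs : 0 < c - s by lra.
  rewrite ler_pdivrMr // => h.
  by rewrite ler_pdivrMr // mulrAC ler_pdivlMr //; lra.
have Ea : ubound E ((f c - f a) / (c - a)).
  by move=> _ [t tcb <-]; apply: three; rewrite // lexx.
have E0 : E !=set0.
  by exists ((f b - f c) / (b - c)), b => //=; rewrite cb lexx.
exists (sup E) => t /andP[at_ tb]; have [tc|ct|->] := ltgtP t c; last first.
- by rewrite subrr mulr0 addr0.
- have : (f t - f c) / (t - c) <= sup E.
    by apply: ub_le_sup; [exists ((f c - f a) / (c - a))|exists t => //=; rewrite ct tb].
  by rewrite ler_pdivrMr; lra.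
have : sup E <= (f c - f t) / (c - t).
  by apply: ge_sup => // _ [s scb <-]; apply: three; rewrite // at_ tc.
by rewrite ler_pdivlMr; lra.
Qed.

End Concave.

(** * Quadratic forms of operator means under affine bounds *)

Section Mean.
Context (R : realType) (H : hilbertType R).
Implicit Types (A B : bop H) (x y : H) (f : R -> R) (a b m M : R).

Lemma ip_sum n (F : 'I_n -> bop H) x :
  ip ((\sum_(j < n) F j) x) x = \sum_(j < n) ip (F j x) x.
Proof.
apply: (big_morph (fun T : bop H => ip (T x) x)) => [S T|]; first exact: ipDl.
exact: ip0l.
Qed.

Lemma sa_one_sub_sum n (k : R) (F : 'I_n -> bop H) : (forall j, sa (F j)) ->
  sa (1 - k%:C *: \sum_(j < n) F j).
Proof. by move=> sF; apply: saB; [exact: sa1|apply: saZ; apply: sa_sum => j _]. Qed.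

Lemma ip_one_sub_sum n (k : R) (F : 'I_n -> bop H) x :
  ip ((1 - k%:C *: \sum_(j < n) F j) x) x = ip x x - k * \sum_(j < n) ip (F j x) x.
Proof.
rewrite -[X in ip X x]/(x - k%:C *: (\sum_(j < n) F j) x).
by rewrite ipDl ipNl ipZl ip_sum.
Qed.

Lemma op_leP A B : op_le A B -> forall x, ip (A x) x <= ip (B x) x.
Proof.
move=> /op_ge0P[_ h] x; have := h x.
by rewrite -[(B - A) x]/(B x - A x) ipDl ipNl subr_ge0.
Qed.

Lemma op_leW A B : sa A -> sa B -> (forall x, ip (A x) x <= ip (B x) x) -> op_le A B.
Proof.
move=> sA sB h; apply/op_ge0P; split; first exact: saB.
by move=> x; rewrite -[(B - A) x]/(B x - A x) ipDl ipNl subr_ge0.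
Qed.

Section MeanBounds.
Context (A B : bop H) (f : R -> R) (m M : R).
Context (pA : spos A) (sB : sa B) (m0 : 0 < m)
  (cf : forall t, 0 < t -> {for t, continuous f})
  (mAB : forall x, m * ip (A x) x <= ip (B x) x)
  (BMA : forall x, ip (B x) x <= M * ip (A x) x).

Let P := op_pow A (- 2^-1).
Let Q := op_pow A 2^-1.
Let X := P * B * P.

Let sX : sa X.
Proof. by apply: sa_conj => //; exact: sa_pow. Qed.

Let PAP x : ip (A (P x)) (P x) = ip x x.
Proof.
rewrite -{1}(pow1 pA) (pow_half _ _ pA) /P pow_apply // nm_sqr.
by rewrite (_ : 1 / 2 - 2^-1 = 0) ?pow0 //; lra.
Qed.

Let lbX x : m * ip x x <= ip (X x) x.
Proof.
rewrite -[X x]/(P (B (P x))) (sa_pow _ pA) -/P -PAP; exact: mAB.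
Qed.

Let ubX x : ip (X x) x <= M * ip x x.
Proof.
rewrite -[X x]/(P (B (P x))) (sa_pow _ pA) -/P -PAP; exact: BMA.
Qed.

Let pX : spos X.
Proof. by split => //; exists m. Qed.

Lemma sa_mean : sa (op_mean f A B).
Proof.
apply: sa_conj; [exact: sa_pow|exact: fc_sa sX (spos_fc pX cf)].
Qed.

Let mean_form x : ip (op_mean f A B x) x = ip (fun_calc f X (Q x)) (Q x).
Proof. by rewrite -[op_mean f A B x]/(Q (fun_calc f X (Q x))) (sa_pow _ pA). Qed.

(** Conjugation by A^(1/2) sends 1 to [A] and [X] back to [B], so an affine bound on [f] becomes a
    linear one in the two forms. *)
Let affine_form a b x :
  ip ((b%:C *: (1 : bop H) + a%:C *: X) (Q x)) (Q x) = a * ip (B x) x + b * ip (A x) x.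
Proof.
rewrite -[X in ip X _]/(b%:C *: Q x + a%:C *: P (B (P (Q x)))).
rewrite ipDl !ipZl (sa_pow (- 2^-1) pA) /P /Q pow_apply // addNr pow0 //.
by rewrite -nm_sqr addrC -{2}(pow1 pA) (pow_half _ _ pA) div1r.
Qed.

Lemma mean_ge a b : (forall t, m <= t <= M -> a * t + b <= f t) ->
  forall x, a * ip (B x) x + b * ip (A x) x <= ip (op_mean f A B x) x.
Proof.
move=> abf x; rewrite mean_form -affine_form.
apply: (fc_le sX (fc_lin a (fc_cst b X) (fc_id X)) (spos_fc pX cf)) => t Xt.
by rewrite addrC abf // (spectrum_ge sX lbX Xt) (spectrum_le sX ubX Xt).
Qed.

Lemma mean_le a b : (forall t, m <= t <= M -> f t <= a * t + b) ->
  forall x, ip (op_mean f A B x) x <= a * ip (B x) x + b * ip (A x) x.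
Proof.
move=> abf x; rewrite mean_form -affine_form.
apply: (fc_le sX (spos_fc pX cf) (fc_lin a (fc_cst b X) (fc_id X))) => t Xt.
by rewrite addrC abf // (spectrum_ge sX lbX Xt) (spectrum_le sX ubX Xt).
Qed.

End MeanBounds.

End Mean.

Theorem theorem2p1 (R : realType) (H : hilbertType R) (f : R -> R)
  (hf : representing_function f)
  (m M : R) (hm : 0 < m) (hM : 0 < M) (hm1 : m < 1) (h1M : 1 < M)
  (n : nat) (A B : 'I_n -> bop H)
  (hA : forall j, op_gt0 (m%:C *: A j))
  (hAB : forall j, op_le (m%:C *: A j) (B j))
  (hBA : forall j, op_le (B j) (M%:C *: A j))
  (hA' : op_gt0 (m%:C *: (1 - (chord_gamma f m M)%:C *: \sum_(j < n) A j)))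
  (hAB' : op_le (m%:C *: (1 - (chord_gamma f m M)%:C *: \sum_(j < n) A j))
                (1 - (chord_gamma f m M)%:C *: \sum_(j < n) B j))
  (hBA' : op_le (1 - (chord_gamma f m M)%:C *: \sum_(j < n) B j)
                (M%:C *: (1 - (chord_gamma f m M)%:C *: \sum_(j < n) A j)))
  (p : R) (hp0 : 0 <= p) (hp1 : p <= 1) :
  op_le
    (op_pow (1 - (chord_gamma f m M)%:C *: \sum_(j < n) op_mean f (A j) (B j)) p)
    ((chord_gamma f m M `^ p)%:C *:
       op_pow (op_mean f (1 - \sum_(j < n) A j) (1 - \sum_(j < n) B j)) p).
Proof.
(* Concavity needs a unit vector, so the zero space is settled apart. *)
have [H0|/existsNP[x0 /eqP x00]] := pselect (forall x : H, x = 0).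
  by move=> x; rewrite [x in inner _ x]H0 linear0r.
have [f0 mf f1] := hf; have cf := mf.1.
have mM : m < M by exact: lt_trans h1M.
have concf a b l : 0 < a -> 0 < b -> 0 <= l <= 1 ->
    l * f a + (1 - l) * f b <= f (l * a + (1 - l) * b).
  exact: operator_monotone_concave x00 mf.
have [_] := chord_gamma_max hf hm mM.
have chord t : m <= t <= M -> chord_slope f m M * t + chord_icpt f m M <= f t.
  exact: concave_chord.
(* The chord at 1 is a weighted mean of f(m) and f(M) with positive weights, because m < 1 < M. *)
have chord1 : 0 < chord_slope f m M + chord_icpt f m M.
  have -> : chord_slope f m M + chord_icpt f m M =
      (f M * (1 - m) + f m * (M - 1)) / (M - m).
    by rewrite /chord_slope /chord_icpt; field; rewrite subr_eq0 gt_eqF.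
  by rewrite divr_gt0 ?subr_gt0 // addr_gt0 // mulr_gt0 ?subr_gt0 ?f0.
have chordm : chord_slope f m M * m + chord_icpt f m M = f m.
  by rewrite /chord_slope /chord_icpt; field; rewrite subr_eq0 gt_eqF.
rewrite /chord_ratio; set mu := chord_slope f m M in chord chord1 chordm *.
set nu := chord_icpt f m M in chord chord1 chordm *.
move: (chord_gamma f m M) hA' hAB' hBA' => g hA' hAB' hBA' gmax.
(* The chord meets [f] at [m], so the ratio there is 1. *)
have g1 : 1 <= g.
  by have := gmax m; rewrite lexx (ltW mM) chordm divff ?gt_eqF ?f0 //; exact.
have g0 : 0 < g by lra.
have gmn : 1 <= g * (mu + nu).
  have := gmax 1; rewrite (ltW hm1) (ltW h1M) f1 mulr1 => /(_ isT).
  by rewrite ler_pdivrMr.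
have [k supp] := concave_support concf hm hm1 h1M.
have sup1 t : m <= t <= M -> f t <= k * t + (1 - k).
  by move/supp; rewrite f1; lra.
have km : 0 < k * m + (1 - k).
  by apply: lt_le_trans (f0 m hm) _; apply: sup1; rewrite lexx ltW.
have kM : 0 < k * M + (1 - k).
  by apply: lt_le_trans (f0 M hM) _; apply: sup1; rewrite lexx ltW.
have unscale (T : bop H) : op_gt0 (m%:C *: T) -> spos T.
  move=> /op_gt0P pT; have := sposZ (c := m^-1) _ pT.
  rewrite scalerA -rmorphM /= mulVf ?gt_eqF // scale1r; apply.
  by rewrite invr_gt0.
have {}hA j : spos (A j) by exact: unscale.
have mABj j x : m * ip (A j x) x <= ip (B j x) x.
  by rewrite -ipZl; exact: op_leP (hAB j) x.
have BMAj j x : ip (B j x) x <= M * ip (A j x) x.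
  by rewrite -ipZl; exact: op_leP (hBA j) x.
have sBj j : sa (B j).
  have /op_ge0P[h _] := hAB j.
  by rewrite -(subrK (m%:C *: A j) (B j)); apply: saD => //; apply: saZ; exact: (hA j).1.
have sAj j : sa (A j) by exact: (hA j).1.
have {hA'} pA' := unscale _ hA'.
have mAB' x := op_leP hAB' x; have BMA' x := op_leP hBA' x.
have [_ [d d0 hd]] := pA'.
pose a x := \sum_(j < n) ip (A j x) x; pose b x := \sum_(j < n) ip (B j x) x.
pose s x := \sum_(j < n) ip (op_mean f (A j) (B j) x) x.
have {}hd x : d * ip x x <= ip x x - g * a x.
  by have := hd x; rewrite ip_one_sub_sum.
have {}mAB' x : m * (ip x x - g * a x) <= ip x x - g * b x.
  by have := mAB' x; rewrite -[X in ip X x]/(m%:C *: _ x) ipZl !ip_one_sub_sum.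
have {}BMA' x : ip x x - g * b x <= M * (ip x x - g * a x).
  by have := BMA' x; rewrite -[X in _ <= ip X x]/(M%:C *: _ x) ipZl !ip_one_sub_sum.
have s_ge x : mu * b x + nu * a x <= s x.
  rewrite /a /b /s !mulr_sumr -big_split; apply: ler_sum => j _.
  exact: (mean_ge (hA j) (sBj j) hm cf (mABj j) (BMAj j)).
have s_le x : s x <= k * b x + (1 - k) * a x.
  rewrite /a /b /s !mulr_sumr -big_split; apply: ler_sum => j _.
  exact: (mean_le (hA j) (sBj j) hm cf (mABj j) (BMAj j)).
have sMj j : sa (op_mean f (A j) (B j)).
  exact: (sa_mean (hA j) (sBj j) hm cf (mABj j)).
set L := 1 - g%:C *: \sum_(j < n) op_mean f (A j) (B j).
have ipL x : ip (L x) x = ip x x - g * s x by exact: ip_one_sub_sum.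
have pL : spos L.
  split; first exact: sa_one_sub_sum.
  (* The minimum over [m, M] of the supporting line k t + (1 - k), attained at an endpoint. *)
  pose kp := Num.min (k * m + (1 - k)) (k * M + (1 - k)).
  have kp0 : 0 < kp by rewrite lt_min km kM.
  exists (kp * d); first exact: mulr_gt0.
  move=> x; rewrite ipL -mulrA.
  apply: (@le_trans _ _ (kp * (ip x x - g * a x))); first by rewrite ler_wpM2l // ltW.
  (* Write u and v for the forms of 1 - g sum A_j and 1 - g sum B_j. As the coefficients k and 1 - k
     add up to 1, the form of [L] is at least k v + (1 - k) u; [h1] and [h2] add up to (M - m) times
     the excess of this over kp u. *)
  have h1 : 0 <= (k * M + (1 - k) - kp) * ((ip x x - g * b x) - m * (ip x x - g * a x)).
    by rewrite mulr_ge0 ?subr_ge0 ?mAB' // ge_min lexx orbT.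
  have h2 : 0 <= (k * m + (1 - k) - kp) * (M * (ip x x - g * a x) - (ip x x - g * b x)).
    by rewrite mulr_ge0 ?subr_ge0 ?BMA' // ge_min lexx.
  have h3 : 0 <= k * (ip x x - g * b x) + (1 - k) * (ip x x - g * a x) -
      kp * (ip x x - g * a x).
    rewrite -(pmulr_rge0 _ (x := M - m)) ?subr_gt0 //.
    by move: (addr_ge0 h1 h2); congr (_ <= _); ring.
  have h4 : g * s x <= g * (k * b x + (1 - k) * a x) by rewrite ler_wpM2l // ltW.
  lra.
have one_sub (F : 'I_n -> bop H) : 1 - \sum_(j < n) F j = 1 - 1%:C *: \sum_(j < n) F j.
  by rewrite scale1r.
have sC : sa (1 - \sum_(j < n) A j) by rewrite one_sub; exact: sa_one_sub_sum.
have sD : sa (1 - \sum_(j < n) B j) by rewrite one_sub; exact: sa_one_sub_sum.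
have ipC x : ip ((1 - \sum_(j < n) A j) x) x = ip x x - a x.
  by rewrite one_sub ip_one_sub_sum mul1r.
have ipD x : ip ((1 - \sum_(j < n) B j) x) x = ip x x - b x.
  by rewrite one_sub ip_one_sub_sum mul1r.
have pC : spos (1 - \sum_(j < n) A j).
  split=> //; exists (d / g); first exact: divr_gt0.
  move=> x; rewrite ipC mulrAC ler_pdivrMr //.
  apply: le_trans (hd x) _; have := mulr_ge0 (_ : 0 <= g - 1) (ip_ge0 x).
  by rewrite subr_ge0 => /(_ g1); lra.
(* g (D - m C) exceeds the corresponding hypothesis by (g - 1)(1 - m), nonnegative since g >= 1 and
   m < 1; the upper bound uses (g - 1)(M - 1) instead. *)
have mCD x : m * ip ((1 - \sum_(j < n) A j) x) x <= ip ((1 - \sum_(j < n) B j) x) x.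
  rewrite ipC ipD -(ler_pM2l g0).
  have : 0 <= (g - 1) * ((1 - m) * ip x x).
    by rewrite !mulr_ge0 ?ip_ge0 ?subr_ge0 // ltW.
  by have := mAB' x; lra.
have DMC x : ip ((1 - \sum_(j < n) B j) x) x <= M * ip ((1 - \sum_(j < n) A j) x) x.
  rewrite ipC ipD -(ler_pM2l g0).
  have : 0 <= (g - 1) * ((M - 1) * ip x x).
    by rewrite !mulr_ge0 ?ip_ge0 ?subr_ge0 // ltW.
  by have := BMA' x; lra.
set K := op_mean f _ _.
have sK : sa K by exact: sa_mean mCD.
(* The chord bound for [K] gives g (mu + nu) |x|^2 - g (mu b + nu a). By [gmn] the first term is at
   least |x|^2, and by [s_ge] the subtracted one is at most g s. *)
have LK x : ip (L x) x <= g * ip (K x) x.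
  have h1 := ler_wpM2l (ltW g0) (mean_ge pC sD hm cf mCD DMC chord x).
  rewrite -/K ipC ipD in h1.
  have h2 := ler_wpM2l (ltW g0) (s_ge x).
  have h3 : 0 <= (g * (mu + nu) - 1) * ip x x by rewrite mulr_ge0 ?ip_ge0 ?subr_ge0.
  rewrite ipL; lra.
(* Strict positivity passes from [L] to [K] through L <= g K. *)
have pK : spos K.
  split=> //; have [_ [c c0 hc]] := pL; exists (c / g); first exact: divr_gt0.
  move=> x; rewrite mulrAC ler_pdivrMr // (mulrC _ g); exact: le_trans (LK x).
rewrite -powZ //; apply: op_leW; first exact: sa_pow.
  by apply: sa_pow; exact: sposZ.
apply: loewner_heinz => //; first exact: sposZ.
by move=> x; rewrite -[(g%:C *: K) x]/(g%:C *: K x) ipZl.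
Qed.
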